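(* Let $(G,P)$ be a quasi-lattice ordered group such that $P$ is directed and $G$ is generated as a group by $P$. Let $\alpha : G\to\mathrm{Aut}(A)$ be an action of $G$ on a $C^*$-algebra $A$, let $\omega : G\times G\to\mathbb T$ be a cocycle, and let $X=X(\alpha,\omega)$ be the associated product system over the opposite semigroup $P^{\mathrm{op}}$ (defined in the context). Then there is an isomorphism $A\times_{\alpha,\omega}G\to\mathcal{NO}_X$ which takes $i_G^{\alpha,\omega}(p)^*i_A^{\alpha,\omega}(x)$ to $j_X(x)$ for all $p\in P$ and $x\in X_p=A$.
   Context: Quasi-lattice ordered groups. $(H,Q)$ is quasi-lattice ordered if $H$ is a discrete group, $Q$ a subsemigroup with $Q\cap Q^{-1}=\{e\}$, and under the order $g\le h\iff g^{-1}h\in Q$ any two elements $p,q$ of $H$ with a common upper bound in $Q$ have a least common upper bound $p\vee q$ in $Q$; $p\vee q=\infty$ means there is no common upper bound in $Q$, and $p\vee q<\infty$ otherwise. $Q$ is directed if $p\vee q<\infty$ for all $p,q\in Q$. In the claim these hypotheses are imposed on $(G,P)$. The twisted system. A cocycle satisfies $\omega(e,e)=1$ and $\omega(gh,k)\omega(g,h)=\omega(g,hk)\omega(h,k)$ for all $g,h,k\in G$. $P^{\mathrm{op}}$ is $P$ with multiplication $p\diamond q=qp$. For $p\in P$, $X_p$ is $A$ as a normed space with $\langle x,y\rangle_A=x^*y$, $a\cdot x=\alpha_p(a)x$, $x\cdot a=xa$; the product of $x\in X_p$ and $y\in X_q$ is $\overline{\omega(q,p)}\,\alpha_q(x)y\in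 X_{qp}=X_{p\diamond q}$. Then $X(\alpha,\omega)=\bigsqcup_{p\in P^{\mathrm{op}}}X_p$ is a product system over $P^{\mathrm{op}}$; it is compactly aligned and its left actions are injective and by compact operators. $A\times_{\alpha,\omega}G$ is the universal $C^*$-algebra generated by a homomorphism $i_A^{\alpha,\omega}$ of $A$ and multiplier unitaries $i_G^{\alpha,\omega}(g)$, $g\in G$, with $i_G^{\alpha,\omega}(g)i_G^{\alpha,\omega}(h)=\omega(g,h)i_G^{\alpha,\omega}(gh)$ and $i_G^{\alpha,\omega}(g)i_A^{\alpha,\omega}(a)i_G^{\alpha,\omega}(g)^*=i_A^{\alpha,\omega}(\alpha_g(a))$. Conventions. For a Hilbert module $Y$, $\mathcal L(Y)$ and $\mathcal K(Y)$ are the adjointable and generalised compact operators; $x\otimes y^*$ denotes $z\mapsto x\cdot\langle y,z\rangle_A$; $\mathcal K({}_AA_A)$ is identified with $A$. The next definitions are written for a product system $X$ over $Q$, where $(H,Q)$ is quasi-lattice ordered; for $X=X(\alpha,\omega)$ they are used with the semigroup $P^{\mathrm{op}}$ in the role of $Q$. Product systems. A product system over $Q$ of right-Hilbert $A$--$A$ bimodules is a semigroup $X$ with a homomorphism $d:X\to Q$ such that each $X_p=d^{-1}(p)$ is a right-Hilbert $A$--$A$ bimodule with left action $\phi_p:A\to\mathcal L(X_p)$, $X_e={}_AA_A$, and multiplication induces isomorphisms $X_p\otimes_AX_q\cong X_{pq}$ ($p,q\ne e$) and implements the actions of $X_e=A$. $\iota_p^{pq}:\mathcal L(X_p)\to\mathcal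 L(X_{pq})$ ($p\neq e$) is given by $\iota_p^{pq}(S)(xy)=(Sx)y$, and $\iota_e^q=\phi_q$ on $\mathcal K(X_e)=A$. $X$ is compactly aligned if $\iota_p^{p\vee q}(S)\iota_q^{p\vee q}(T)\in\mathcal K(X_{p\vee q})$ whenever $p\vee q<\infty$, $S\in\mathcal K(X_p)$, $T\in\mathcal K(X_q)$. A representation $\psi:X\to B$ is multiplicative, linear on fibres, with $\psi_e$ a homomorphism and $\psi_e(\langle x,y\rangle_A)=\psi_p(x)^*\psi_p(y)$ for $x,y\in X_p$, where $\psi_p=\psi|_{X_p}$; $\psi^{(p)}(x\otimes y^* )=\psi_p(x)\psi_p(y)^*$ defines a homomorphism $\psi^{(p)}:\mathcal K(X_p)\to B$. It is Nica covariant if, for all $S\in\mathcal K(X_p)$ and $T\in\mathcal K(X_q)$, $\psi^{(p)}(S)\psi^{(q)}(T)$ equals $\psi^{(p\vee q)}(\iota_p^{p\vee q}(S)\iota_q^{p\vee q}(T))$ if $p\vee q<\infty$ and $0$ otherwise. $\mathcal{NO}_X$. Put $I_e=A$, $I_q=\bigcap_{e<p\le q}\ker\phi_p$ for $q\ne e$, $\widetilde X_q=\bigoplus_{p\le q}X_p\cdot I_{p^{-1}q}$ with left action $\tilde\phi_q$; $X$ is $\tilde\phi$-injective if all $\tilde\phi_q$ are injective (automatic when all $\phi_p$ are injective). $\tilde\iota_p^q(T)=\bigoplus_{r\le q}\iota_p^r(T)$ with $\iota_p^r(T)=0$ if $p\not\le r$. A property holds for large $s$ if for every $q\in Q$ there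 is $r\ge q$ such that it holds for all $s\ge r$. A Nica covariant $\psi$ is CNP-covariant if $\sum_{p\in F}\psi^{(p)}(T_p)=0$ whenever $F\subset Q$ is finite, $T_p\in\mathcal K(X_p)$ and $\sum_{p\in F}\tilde\iota_p^q(T_p)=0$ for large $q$. $\mathcal{NO}_X$ is the universal $C^*$-algebra generated by a CNP-covariant representation $j_X$.
   Formalization: The formal theorem also assumes that the opposite semigroup P^op is directed (any two elements have a common upper bound for its own order); without this the claim is false whenever A is nonzero, since directedness of P does not imply it. *)

(* Defs.v *)
From HB Require Import structures.
From mathcomp Require Import all_boot all_order all_algebra.
From mathcomp Require Import complex.
From mathcomp Require Import all_classical all_reals all_analysis.

Set Implicit Arguments.
Unset Strict Implicit.
Unset Printing Implicit Defensive.

Import Order.TTheory GRing.Theory Num.Theory.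
Import numFieldNormedType.Exports.

Local Open Scope classical_set_scope.
Local Open Scope complex_scope.
Local Open Scope ring_scope.

Declare Scope cstar_scope.
Delimit Scope cstar_scope with cstar.
Local Open Scope cstar_scope.

Reserved Notation "x ** y" (at level 40, left associativity).

HB.mixin Record CompleteNormedModule_isCStar (R : realType) A
    of CompleteNormedModule R[i] A := {
  cmul : A -> A -> A;
  star : A -> A;
  cmulA : forall a b c, cmul a (cmul b c) = cmul (cmul a b) c;
  cmulDl : forall a b c, cmul (a + b) c = cmul a c + cmul b c;
  cmulDr : forall a b c, cmul a (b + c) = cmul a b + cmul a c;
  cmulZl : forall (l : R[i]) a b, cmul (l *: a) b = l *: cmul a b;
  cmulZr : forall (l : R[i]) a b, cmul a (l *: b) = l *: cmul a b;
  starK : forall a, star (star a) = a;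
  starD : forall a b, star (a + b) = star a + star b;
  starZ : forall (l : R[i]) a, star (l *: a) = Num.conj l *: star a;
  starM : forall a b, star (cmul a b) = cmul (star b) (star a);
  cnormM : forall a b, `|cmul a b| <= `|a| * `|b|;
  cnorm_star : forall a, `|cmul (star a) a| = `|a| ^+ 2
}.

#[short(type="cstarAlgType")]
HB.structure Definition CStarAlgebra (R : realType) :=
  { A of CompleteNormedModule_isCStar R A & CompleteNormedModule R[i] A }.

Notation "x ** y" := (cmul x y) : cstar_scope.

Section CStarTheory.
Context {R : realType}.
Implicit Types A B : cstarAlgType R.

Definition cstar_hom A B (f : A -> B) : Prop :=
  [/\ forall a b, f (a + b) = f a + f b,
      forall (l : R[i]) a, f (l *: a) = l *: f a,
      forall a b, f (a ** b) = f a ** f b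
    & forall a, f (star a) = star (f a)].

Definition cstar_subalgebra B (D : set B) : Prop :=
  [/\ closed D,
      [/\ D 0, forall a b, D a -> D b -> D (a + b)
        & forall (l : R[i]) a, D a -> D (l *: a)],
      forall a b, D a -> D b -> D (a ** b)
    & forall a, D a -> D (star a)].

Definition generates B (S : set B) : Prop :=
  forall D : set B, cstar_subalgebra D -> S `<=` D -> D = setT.

(** [M(B)] as the adjointable operators on [B] regarded as a right Hilbert
    module over itself with inner product [x^* y]. A product [m b] with
    [b : B] lies in [B]: it is the value of the operator [m] at [b]. *)
Record multiplier B := Multiplier {
  mult_fun :> B -> B;
  mult_adj : B -> B;
  _ : forall x y, star (mult_fun x) ** y = star x ** mult_adj y
}.

Definition mult_unitary B (m : multiplier B) : Prop :=
  (forall b, mult_adj m (m b) = b) /\ (forall b, m (mult_adj m b) = b).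

End CStarTheory.

Section QuasiLattice.
Context {H : groupType}.
Implicit Types (Q : set H) (p q r : H).

(** For [H := oppg G] this reads [Q (q * p^-1)] in [G]. *)
Definition qle Q p q : Prop := Q (p^-1 * q)%g.

Definition common_ub Q p q r : Prop := [/\ Q r, qle Q p r & qle Q q r].

Definition is_join Q p q r : Prop :=
  common_ub Q p q r /\ forall s, common_ub Q p q s -> qle Q r s.

Definition quasi_lattice_ordered Q : Prop :=
  [/\ forall p q, Q p -> Q q -> Q (p * q)%g,
      Q `&` [set p | Q p^-1%g] = [set 1%g]
    & forall p q, (exists r, common_ub Q p q r) -> exists r, is_join Q p q r].

Definition directed Q : Prop :=
  forall p q, Q p -> Q q -> exists r, common_ub Q p q r.

Definition generated_by Q : Prop :=
  forall K : set H, K 1%g -> (forall p q, K p -> K q -> K (p * q)%g) ->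
    (forall p, K p -> K p^-1%g) -> Q `<=` K -> K = setT.

Definition for_large Q (property : H -> Prop) : Prop :=
  forall q, Q q ->
    exists r, [/\ Q r, qle Q q r & forall s, Q s -> qle Q r s -> property s].

End QuasiLattice.

Definition oppg (G : groupType) : Type := G.

Section OppositeGroup.
Context {G : groupType}.

HB.instance Definition _ := Choice.on (oppg G).

Lemma oppg_mulA : associative (fun p q : oppg G => (q * p)%g : oppg G).
Proof. by move=> p q r; rewrite mulgA. Qed.
Lemma oppg_mul1 :
  left_id (1%g : oppg G) (fun p q : oppg G => (q * p)%g : oppg G).
Proof. by move=> p; rewrite mulg1. Qed.
Lemma oppg_1mul :
  right_id (1%g : oppg G) (fun p q : oppg G => (q * p)%g : oppg G).
Proof. by move=> p; rewrite mul1g. Qed.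
Lemma oppg_mulV : left_inverse (1%g : oppg G) (fun p => p^-1%g)
  (fun p q : oppg G => (q * p)%g : oppg G).
Proof. by move=> p; rewrite mulgV. Qed.
Lemma oppg_Vmul : right_inverse (1%g : oppg G) (fun p => p^-1%g)
  (fun p q : oppg G => (q * p)%g : oppg G).
Proof. by move=> p; rewrite mulVg. Qed.

HB.instance Definition _ := isGroup.Build (oppg G)
  oppg_mulA oppg_mul1 oppg_1mul oppg_mulV oppg_Vmul.

Definition opp_cone (P : set G) : set (oppg G) := P.

End OppositeGroup.

Record hilbert_bimodule {R : realType} (A : cstarAlgType R) := HilbertBimodule {
  hb_car :> completeNormedModType R[i];
  inner : hb_car -> hb_car -> A;
  ract : hb_car -> A -> hb_car;
  lact : A -> hb_car -> hb_car;
  ractDl : forall x y a, ract (x + y) a = ract x a + ract y a;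
  ractDr : forall x a b, ract x (a + b) = ract x a + ract x b;
  ractZl : forall (l : R[i]) x a, ract (l *: x) a = l *: ract x a;
  ractZr : forall (l : R[i]) x a, ract x (l *: a) = l *: ract x a;
  ractA : forall x a b, ract x (a ** b) = ract (ract x a) b;
  innerDr : forall x y z, inner x (y + z) = inner x y + inner x z;
  innerZr : forall (l : R[i]) x y, inner x (l *: y) = l *: inner x y;
  inner_ract : forall x y a, inner x (ract y a) = inner x y ** a;
  inner_star : forall x y, star (inner x y) = inner y x;
  inner_ge0 : forall x, exists b, inner x x = star b ** b;
  inner_norm : forall x, `|x| ^+ 2 = `|inner x x|;
  lactDl : forall a b x, lact (a + b) x = lact a x + lact b x;
  lactZl : forall (l : R[i]) a x, lact (l *: a) x = l *: lact a x;
  lactA : forall a b x, lact (a ** b) x = lact a (lact b x);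
  lact_adj : forall a x y, inner (lact a x) y = inner x (lact (star a) y)
}.

Section BimoduleTheory.
Context {R : realType} {A : cstarAlgType R}.
Implicit Types Y Z W : hilbert_bimodule A.

Definition adjoint_of Y (S T : Y -> Y) : Prop :=
  forall x y, inner (S x) y = inner x (T y).

Definition adjointable Y (S : Y -> Y) : Prop := exists T, adjoint_of S T.

Definition rank_one Y (x y : Y) : Y -> Y := fun z => ract x (inner y z).

(** The operator-norm closure of the span of the [rank_one x y]; scalars are
    absorbed in [x]. *)
Definition compact_op Y (S : Y -> Y) : Prop :=
  adjointable S /\
  forall e : R[i], 0 < e -> exists s : seq (Y * Y),
    forall z, `|S z - \sum_(u <- s) rank_one u.1 u.2 z| <= e * `|z|.

(** [m] induces an isomorphism of right-Hilbert bimodules from the balanced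
    tensor product of [Y] and [Z] onto [W]: it preserves the inner product of
    elementary tensors and both actions, and its range spans a dense subspace. *)
Definition induces_tensor_iso Y Z W (m : Y -> Z -> W) : Prop :=
  [/\ forall x y x' y',
        inner (m x y) (m x' y') = inner y (lact (inner x x') y'),
      forall a x y, m (lact a x) y = lact a (m x y),
      forall x y a, m x (ract y a) = ract (m x y) a
    & forall (w : W) (e : R[i]), 0 < e -> exists s : seq (Y * Z),
        `|w - \sum_(u <- s) m u.1 u.2| <= e].

End BimoduleTheory.

(** A product system over the subsemigroup [Q] of [H]. Only the fibres over [Q]
    matter: no axiom constrains the multiplication of the other ones. The
    semigroup is [{p : H & fibre p}], so that its laws are equations between
    dependent pairs; [ps_unit] is the identification of [A] with the fibre over
    the identity. *)
Record product_system {R : realType} (A : cstarAlgType R) (H : groupType)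
    (Q : set H) := ProductSystem {
  fibre :> H -> hilbert_bimodule A;
  ps_mul : forall p q, fibre p -> fibre q -> fibre (p * q)%g;
  ps_unit : A -> fibre 1%g;
  ps_unitD : forall a b, ps_unit (a + b) = ps_unit a + ps_unit b;
  ps_unitZ : forall (l : R[i]) a, ps_unit (l *: a) = l *: ps_unit a;
  ps_unit_bij : bijective ps_unit;
  ps_unit_inner : forall a b, inner (ps_unit a) (ps_unit b) = star a ** b;
  ps_unit_ract : forall a b, ract (ps_unit a) b = ps_unit (a ** b);
  ps_unit_lact : forall a b, lact a (ps_unit b) = ps_unit (a ** b);
  ps_mulA : forall p q r (x : fibre p) (y : fibre q) (z : fibre r),
    Q p -> Q q -> Q r ->
    existT (fun p => fibre p : Type) _ (ps_mul (ps_mul x y) z) =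
    existT (fun p => fibre p : Type) _ (ps_mul x (ps_mul y z));
  ps_mul_unitl : forall p a (x : fibre p), Q p ->
    existT (fun p => fibre p : Type) _ (ps_mul (ps_unit a) x) =
    existT (fun p => fibre p : Type) _ (lact a x);
  ps_mul_unitr : forall p (x : fibre p) a, Q p ->
    existT (fun p => fibre p : Type) _ (ps_mul x (ps_unit a)) =
    existT (fun p => fibre p : Type) _ (ract x a);
  ps_mul_tensor : forall p q, Q p -> Q q -> p <> 1%g -> q <> 1%g ->
    induces_tensor_iso (@ps_mul p q)
}.

Section CuntzNicaPimsner.
Context {R : realType} {A : cstarAlgType R} {H : groupType} {Q : set H}.
Variable X : product_system A Q.

(** [z = x y] in the semigroup [X]. *)
Definition is_product p r q (x : X p) (y : X r) (z : X q) : Prop :=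
  existT (fun p => X p : Type) _ (ps_mul x y) =
  existT (fun p => X p : Type) _ z.

Definition ps_iota_spec p q (S : X p -> X p) (T : X q -> X q) : Prop :=
  adjointable T /\
  if p == 1%g
  then exists a : A, (forall x, S x = lact a x) /\ (forall y, T y = lact a y)
  else forall r (x : X p) (y : X r) (z w : X q), Q r ->
         is_product x y z -> is_product (S x) y w -> T z = w.

(** [iota_p^q (S)], for [p <= q]; the operator [T] in [ps_iota_spec] is unique. *)
Definition ps_iota p q (S : X p -> X p) : X q -> X q :=
  xget (fun=> 0) [set T | ps_iota_spec S T].
Arguments ps_iota {p} q S.

Definition ideal_I q : set A :=
  [set a | q = 1%g \/
     forall p, Q p -> p <> 1%g -> qle Q p q -> forall x : X p, lact a x = 0].

(** The Hilbert module direct sum of the [X_r I_{r^{-1} q}], [r <= q]. *)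
Definition Xtilde q : set (forall r, X r) :=
  [set x | [/\ forall r, Q r -> qle Q r q ->
                 exists (y : X r) (a : A), ideal_I (r^-1 * q)%g a /\
                   x r = ract y a,
               forall r, ~ (Q r /\ qle Q r q) -> x r = 0
             & exists b : A, forall e : R[i], 0 < e ->
                 exists s0 : seq H, forall s : seq H, uniq s ->
                   {subset s0 <= s} ->
                   `|\sum_(r <- s) inner (x r) (x r) - b| <= e]].

(** [iota~_p^q (T)], acting on the elements of [Xtilde q]. *)
Definition iota_tilde p q (T : X p -> X p) (x : forall r, X r) r : X r :=
  if `[< [/\ Q r, qle Q r q & qle Q p r] >] then ps_iota r T (x r) else 0.

Arguments iota_tilde {p} q T x r.

Section Representations.
Context {B : cstarAlgType R}.

Definition representation (psi : forall p, X p -> B) : Prop :=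
  [/\ forall p, Q p -> (forall x y : X p, psi p (x + y) = psi p x + psi p y) /\
        (forall (l : R[i]) (x : X p), psi p (l *: x) = l *: psi p x),
      forall p q (x : X p) (y : X q), Q p -> Q q ->
        psi (p * q)%g (ps_mul x y) = psi p x ** psi q y,
      cstar_hom (fun a => psi 1%g (ps_unit X a))
    & forall p (x y : X p), Q p ->
        psi 1%g (ps_unit X (inner x y)) = star (psi p x) ** psi p y].

(** [psiK] is the homomorphism [psi^(p)]: it is determined on [K(X_p)] by these
    conditions, and its values elsewhere are irrelevant. *)
Definition is_psi_compact p (psi_p : X p -> B) (psiK : (X p -> X p) -> B)
    : Prop :=
  [/\ forall S T, compact_op S -> compact_op T ->
        psiK (fun x => S x + T x) = psiK S + psiK T,
      forall (l : R[i]) S, compact_op S ->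
        psiK (fun x => l *: S x) = l *: psiK S,
      forall S T, compact_op S -> compact_op T ->
        psiK (S \o T) = psiK S ** psiK T,
      forall S T, compact_op S -> compact_op T -> adjoint_of S T ->
        psiK T = star (psiK S)
    & forall x y, psiK (rank_one x y) = psi_p x ** star (psi_p y)].

Definition nica_covariant (psiK : forall p, (X p -> X p) -> B) : Prop :=
  forall p q (S : X p -> X p) (T : X q -> X q),
    Q p -> Q q -> compact_op S -> compact_op T ->
    (forall r, is_join Q p q r ->
       psiK p S ** psiK q T = psiK r (ps_iota r S \o ps_iota r T)) /\
    (~ (exists r, common_ub Q p q r) -> psiK p S ** psiK q T = 0).

Definition cuntz_pimsner_covariant (psiK : forall p, (X p -> X p) -> B)
    : Prop :=
  forall (F : seq H) (T : forall p, X p -> X p),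
    uniq F -> (forall p, p \in F -> Q p /\ compact_op (T p)) ->
    for_large Q (fun q => forall x, Xtilde q x -> forall r,
      \sum_(p <- F) iota_tilde q (T p) x r = 0) ->
    \sum_(p <- F) psiK p (T p) = 0.

Definition cnp_representation (psi : forall p, X p -> B) : Prop :=
  representation psi /\
  exists psiK : forall p, (X p -> X p) -> B,
    [/\ forall p, Q p -> is_psi_compact (psi p) (psiK p),
        nica_covariant psiK
      & cuntz_pimsner_covariant psiK].

End Representations.

(** [(N, j)] is [NO_X] with its universal representation [j_X]. *)
Definition is_NO (N : cstarAlgType R) (j : forall p, X p -> N) : Prop :=
  [/\ cnp_representation j,
      generates [set b | exists p (x : X p), Q p /\ b = j p x]
    & forall (B : cstarAlgType R) (psi : forall p, X p -> B),
        cnp_representation psi ->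
        exists! rho : N -> B, cstar_hom rho /\
          forall p (x : X p), Q p -> rho (j p x) = psi p x].

End CuntzNicaPimsner.

(** The inverse of [alpha g] is [alpha g^-1], so each [alpha g] is an
    automorphism. *)
Record cstar_action {R : realType} (G : groupType) (A : cstarAlgType R) :=
  CStarAction {
  act_fun :> G -> A -> A;
  act_hom : forall g, cstar_hom (act_fun g);
  act1 : forall a, act_fun 1%g a = a;
  actM : forall g h a, act_fun (g * h)%g a = act_fun g (act_fun h a)
}.

Record cocycle (R : realType) (G : groupType) := Cocycle {
  coc_fun :> G -> G -> R[i];
  coc_norm : forall g h, `|coc_fun g h| = 1;
  coc1 : coc_fun 1%g 1%g = 1;
  cocM : forall g h k, coc_fun (g * h)%g k * coc_fun g h =
                       coc_fun g (h * k)%g * coc_fun h k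
}.

Section CrossedProduct.
Context {R : realType} {G : groupType} {A : cstarAlgType R}.
Variables (alpha : cstar_action G A) (omega : cocycle R G).

Definition covariant_pair (B : cstarAlgType R) (pi : A -> B)
    (U : G -> multiplier B) : Prop :=
  [/\ cstar_hom pi,
      forall g, mult_unitary (U g),
      forall g h b, U g (U h b) = omega g h *: U (g * h)%g b
    & forall g a b, U g (pi a ** mult_adj (U g) b) = pi (alpha g a) ** b].

(** [(C, iA, iG)] is the universal triple defining the twisted crossed product;
    the last condition says that the extension of [rho] to multipliers sends
    [iG g] to [U g]. *)
Definition is_crossed_product (C : cstarAlgType R) (iA : A -> C)
    (iG : G -> multiplier C) : Prop :=
  [/\ covariant_pair iA iG,
      generates [set c | exists g a, c = iG g (iA a)]
    & forall (B : cstarAlgType R) (pi : A -> B) (U : G -> multiplier B),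
        covariant_pair pi U ->
        exists! rho : C -> B, [/\ cstar_hom rho,
          forall a, rho (iA a) = pi a
        & forall g c, rho (iG g c) = U g (rho c)]].

End CrossedProduct.

(** Products span a dense subspace of a C*-algebra; this is what makes [X(alpha,
    omega)] a product system. *)
Section ProductsDense.
Context {R : realType} {A : cstarAlgType R}.
Implicit Types (a b c : A) (e l : R[i]).

Lemma cmul0l b : 0 ** b = 0.
Proof. by apply: (addrI (0 ** b)); rewrite -cmulDl !addr0. Qed.
Lemma cmul0r b : b ** 0 = 0.
Proof. by apply: (addrI (b ** 0)); rewrite -cmulDr !addr0. Qed.
Lemma cmulNl a b : (- a) ** b = - (a ** b).
Proof. by rewrite -scaleN1r cmulZl scaleN1r. Qed.
Lemma cmulNr a b : a ** (- b) = - (a ** b).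
Proof. by rewrite -scaleN1r cmulZr scaleN1r. Qed.
Lemma cmulBl a b c : (a - b) ** c = a ** c - b ** c.
Proof. by rewrite cmulDl cmulNl. Qed.
Lemma cmulBr a b c : a ** (b - c) = a ** b - a ** c.
Proof. by rewrite cmulDr cmulNr. Qed.
Lemma star0 : star (0 : A) = 0.
Proof. by apply: (addrI (star (0 : A))); rewrite -starD !addr0. Qed.
Lemma starN a : star (- a) = - star a.
Proof. by rewrite -scaleN1r starZ rmorphN1 scaleN1r. Qed.

Lemma norm_star_le a : `|a| <= `|star a|.
Proof.
have [->|a0] := eqVneq a 0; first by rewrite normr0.
rewrite -(ler_pM2r (x := `|a|)) ?normr_gt0 //.
by rewrite -expr2 -cnorm_star cnormM.
Qed.

Lemma norm_star a : `|star a| = `|a|.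
Proof.
apply/eqP; rewrite eq_le norm_star_le -{2}(starK a) norm_star_le.
by [].
Qed.

Lemma pow2_small e : 0 < e ->
  exists N, forall n, (N <= n)%N -> 2 * (2^-1) ^+ n <= e.
Proof.
move=> e0; have eE : e = (complex.Re e)%:C.
  by rewrite RRe_real// gtr0_real.
have r0 : 0 < complex.Re e / 2 by rewrite divr_gt0// -ltcR -eE.
have [N _ HN] := near_infty_natSinv_expn_lt (PosNum r0).
exists N => n /HN /= /ltW Hn.
have -> : 2 * (2^-1) ^+ n = (2 * (1 / 2 ^+ n))%:C :> R[i].
  by rewrite div1r -exprVn rmorphM rmorphXn fmorphV /= !rmorph_nat.
by rewrite eE lecR mulrC -ler_pdivlMr.
Qed.

Lemma quasi_inverse b : `|b| <= 2^-1 ->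
  exists r, r = b + b ** r /\ r = b + r ** b.
Proof.
move=> b2.
pose s := fix s n := if n is n'.+1 then b + b ** s n' else 0.
have sS n : s n.+1 = b + b ** s n by [].
have sS' n : s n.+1 = b + s n ** b.
  elim: n => [|n IH]; first by rewrite sS cmul0l cmul0r.
  by rewrite sS {1}IH sS cmulDr cmulDl cmulA.
have ds n : `|s n.+1 - s n| <= (2^-1) ^+ n.+1.
  elim: n => [|n IH]; first by rewrite sS cmul0r addr0 subr0 expr1.
  rewrite !sS opprD addrACA subrr add0r -cmulBr exprS.
  apply: le_trans (cnormM _ _) _; exact: ler_pM.
have dsm n m : `|s (n + m)%N - s n| <= (2^-1) ^+ n - (2^-1) ^+ (n + m).
  elim: m => [|m IH]; first by rewrite addn0 !subrr normr0.
  rewrite addnS -(subrKA (s (n + m)%N)).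
  apply: le_trans (ler_normD _ _) _.
  apply: le_trans (lerD (ds _) IH) _.
  have -> : (2^-1) ^+ (n + m) = (2^-1) ^+ (n + m).+1 *+ 2 :> R[i].
    by rewrite exprS -mulrnAl -[2^-1 *+ 2]mulr_natr mulVf ?pnatr_eq0// mul1r.
  by rewrite mulr2n opprD addrCA addNKr.
have dsle n m : (n <= m)%N -> `|s m - s n| <= (2^-1) ^+ n.
  move=> /subnKC <-; apply: le_trans (dsm _ _) _.
  by rewrite gerBl exprn_ge0// invr_ge0.
have /cvg_ex[r sr] : cvg (s @ \oo).
  apply/cauchy_cvgP/cauchyP => e e0.
  have [N HN] := pow2_small e0.
  exists (s N); exists N => // n /= Nn.
  rewrite -ball_normE /= distrC; apply: le_lt_trans (dsle _ _ Nn) _.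
  apply: lt_le_trans (HN N (leqnn _)).
  by rewrite mulr_natl mulr2n ltrDl exprn_gt0// invr_gt0.
exists r.
have cvM (f : A -> A) : (forall x y, f x - f y = f (x - y)) ->
    (forall x, `|f x| <= `|b| * `|x|) -> (forall n, s n.+1 = b + f (s n)) ->
    r = b + f r.
  move=> fB fb sf.
  apply: (@cvg_unique _ (@norm_hausdorff _ A) (s n @[n --> \oo])) => //.
  apply/cvgrPdist_le => e e0.
  move/cvgrPdist_le : sr => /(_ e e0)[N _ HN].
  exists N.+1 => // -[//|n] Nn.
  rewrite sf opprD addrACA subrr add0r fB; apply: le_trans (fb _) _.
  apply: le_trans (HN n Nn); rewrite ler_piMl//.
  by apply: le_trans b2 _; rewrite invf_le1// ler1n.
split.
  apply: (cvM (fun x => b ** x)) => // [x y|x]; first by rewrite cmulBr.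
  exact: cnormM.
apply: (cvM (fun x => x ** b)) => // [x y|x]; first by rewrite cmulBl.
by rewrite mulrC; exact: cnormM.
Qed.

Definition prod_sum a := exists s : seq (A * A), a = \sum_(u <- s) u.1 ** u.2.

Lemma prod_sumD a b : prod_sum a -> prod_sum b -> prod_sum (a + b).
Proof. by move=> [s ->] [t ->]; exists (s ++ t); rewrite big_cat. Qed.

Lemma prod_sumZ l a : prod_sum a -> prod_sum (l *: a).
Proof.
move=> [s ->]; exists [seq (l *: u.1, u.2) | u <- s].
by rewrite big_map scaler_sumr; apply: eq_bigr => u _; rewrite cmulZl.
Qed.

Lemma prod_sum1 a b : prod_sum (a ** b).
Proof. by exists [:: (a, b)]; rewrite big_seq1. Qed.

Definition prod_lim a :=
  forall e, 0 < e -> exists2 d, prod_sum d & `|a - d| <= e.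

Lemma prod_limD a b : prod_lim a -> prod_lim b -> prod_lim (a + b).
Proof.
move=> Ha Hb e e0; have e2 : 0 < e / 2 by rewrite divr_gt0.
have [c Hc ac] := Ha _ e2; have [d Hd bd] := Hb _ e2.
exists (c + d); first exact: prod_sumD.
rewrite opprD addrACA (splitr e).
by apply: le_trans (ler_normD _ _) _; apply: lerD.
Qed.

Lemma prod_limZ l a : prod_lim a -> prod_lim (l *: a).
Proof.
move=> Ha e e0; have l0 : 0 < `|l| + 1 by rewrite ltr_wpDl.
have [c Hc ac] := Ha (e / (`|l| + 1)) (divr_gt0 e0 l0).
exists (l *: c); first exact: prod_sumZ.
rewrite -scalerBr normrZ.
apply: le_trans (_ : (`|l| + 1) * `|a - c| <= e).
  by rewrite ler_wpM2r// lerDl.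
by rewrite mulrC -ler_pdivlMr.
Qed.

(** For small skew-adjoint [b], the Cayley transform [1 + E] of [b] is unitary
    and [E] is [2 b] up to products; the powers [1 + E n] are unitary as well,
    hence [`|E n| <= 2], while [E n] is [2 n b] up to products. *)
Lemma prod_lim_small_skew b : star b = - b -> `|b| <= 2^-1 -> prod_lim b.
Proof.
move=> sb b2; have [r [rl rr]] := quasi_inverse b2.
have srl : star r = - b - star r ** b.
  by rewrite {1}rl starD starM sb cmulNr.
have srb : star r ** b = - b - star r.
  by rewrite {2}srl opprB addrCA subrr addr0.
have srr : star r ** r + star r ** r = - (r + star r).
  have h : star r ** r = - (r + star r) - star r ** r.
    rewrite {2}rl cmulDr cmulA srb cmulBl cmulNl addrA; congr (_ - _).
    by rewrite [- b - _]addrC -addrA -opprD -rl -opprD addrC.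
  by rewrite {1}h subrK.
have [E1 E1r sE1] : exists2 E1, E1 = r + r
    & star E1 ** E1 = - (E1 + star E1).
  exists (r + r) => //; by rewrite starD cmulDl !cmulDr srr -opprD addrACA.
pose E := fix E n := if n is n'.+1 then E1 + (E n' + E1 ** E n') else 0.
have sE n : star (E n) ** E n = - (E n + star (E n)).
  elim: n => [|n IH]; first by rewrite star0 cmul0l addr0 oppr0.
  rewrite /= -/(E n); set v := E n + _.
  have E1v : star E1 ** v = - (E1 ** E n).
    rewrite /v cmulDr cmulA sE1 cmulNl cmulDl opprD addrCA.
    by rewrite addrN addr0.
  have vv : star v ** v = - (E n + star (E n)).
    rewrite {1}/v starD cmulDl starM -cmulA E1v {1}/v cmulDr IH.
    by rewrite cmulNr addrK.
  have vE1 : star v ** E1 = - star (E1 ** E n).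
    by rewrite -(starK E1) -starM E1v starN starK.
  have vE : v = E n + E1 ** E n by [].
  clearbody v; rewrite starD cmulDl !cmulDr sE1 E1v vE1 vv vE starD.
  rewrite -!opprD; congr (- _).
  by rewrite [LHS](AC (3*(1*2)) ((1*(5*3))*(2*(6*4))))/=.
have nE n : `|E n| <= 2.
  have [->|E0] := eqVneq (E n) 0; first by rewrite normr0.
  rewrite -(ler_pM2r (x := `|E n|)) ?normr_gt0 // -expr2 -cnorm_star sE normrN.
  apply: le_trans (ler_normD _ _) _.
  by rewrite norm_star mulr_natl mulr2n.
have dE n : exists2 d, prod_sum d & E n = n%:R *: (2 *: b) + d.
  elim: n => [|n [d Hd IH]].
    by exists 0; [exists [::]; rewrite big_nil | rewrite scale0r addr0].
  exists (d + E1 ** E n + (b ** r + b ** r)).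
    by do! apply: prod_sumD => //; exact: prod_sum1.
  have E1b : E1 = 2 *: b + (b ** r + b ** r).
    by rewrite E1r {1 2}rl addrACA scaler_nat mulr2n.
  rewrite /= -/(E n); move: (E1 ** E n) => y; rewrite E1b IH.
  move: (2 *: b) => w; rewrite -[n.+1%:R]natr1 scalerDl scale1r.
  move: (n%:R *: w) => u.
  by rewrite [LHS](AC (2*(2*1)) ((3*1)*((4*5)*2))).
move=> e e0.
have [n n0 ne] : exists2 n, (0 < n)%N & n%:R^-1 <= e.
  have [N HN] := pow2_small e0; exists (2 ^ N)%N; first by rewrite expn_gt0.
  by apply: le_trans (HN N (leqnn _)); rewrite natrX exprVn ler_peMl// ?ler1n//.
have [d Hd Ed] := dE n.
exists (- (n%:R^-1 / 2) *: d); first exact: prod_sumZ.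
have -> : b - (- (n%:R^-1 / 2) *: d) = (n%:R^-1 / 2) *: E n.
  rewrite Ed scalerDr scaleNr opprK !scalerA; congr (_ + _).
  rewrite -!mulrA [2^-1 * _]mulrCA mulVf ?pnatr_eq0// mulr1 mulVf ?scale1r//.
  by rewrite pnatr_eq0 -lt0n.
rewrite normrZ ger0_norm ?divr_ge0 ?invr_ge0//.
apply: le_trans ne; rewrite -[leRHS]mulr1 -mulrA ler_wpM2l ?invr_ge0//.
by rewrite mulrC ler_pdivrMr// mul1r nE.
Qed.

Lemma prod_lim_skew b : star b = - b -> prod_lim b.
Proof.
move=> sb; have l0 : 0 < `|b| + `|b| + 1 by rewrite ltr_wpDl// addr_ge0.
rewrite -[b](scalerKV (a := `|b| + `|b| + 1)) ?gt_eqF//.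
apply: prod_limZ; apply: prod_lim_small_skew.
  rewrite starZ sb scalerN fmorphV; congr (- (_^-1 *: _)).
  by apply/CrealP; rewrite gtr0_real.
rewrite normrZ normfV (gtr0_norm l0) mulrC ler_pdivrMr//.
rewrite mulrC ler_pdivlMr// mulr_natr mulr2n.
by rewrite lerDl.
Qed.

Lemma prod_lim_all a : prod_lim a.
Proof.
have -> : a = 2^-1 *: (a - star a) + ('i * 2)^-1 *: ('i *: (a + star a)).
  rewrite scalerA invfM mulrAC mulVf ?neq0Ci// mul1r -scalerDr.
  rewrite addrACA addNr addr0 -mulr2n -[a *+ 2]scaler_nat scalerA.
  by rewrite mulVf ?pnatr_eq0// scale1r.
apply: prod_limD; apply: prod_limZ; apply: prod_lim_skew.
  by rewrite starD starN starK opprB addrC.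
by rewrite starZ starD starK conjCi scaleNr addrC.
Qed.

End ProductsDense.

Section TwistedSystem.
Context {R : realType} {G : groupType} {A : cstarAlgType R}.
Variables (alpha : cstar_action G A) (omega : cocycle R G) (P : set G).

Lemma actD g a b : alpha g (a + b) = alpha g a + alpha g b.
Proof. by case: (act_hom alpha g). Qed.
Lemma actZ g (l : R[i]) a : alpha g (l *: a) = l *: alpha g a.
Proof. by case: (act_hom alpha g). Qed.
Lemma act_mul g a b : alpha g (a ** b) = alpha g a ** alpha g b.
Proof. by case: (act_hom alpha g). Qed.
Lemma act_star g a : alpha g (star a) = star (alpha g a).
Proof. by case: (act_hom alpha g). Qed.
Lemma actVK g a : alpha g (alpha g^-1%g a) = a.
Proof. by rewrite -actM mulgV act1. Qed.
Lemma coc_conjK g h : Num.conj (omega g h) * omega g h = 1.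
Proof. by rewrite mulrC -normCK coc_norm expr1n. Qed.

Section Fibre.
Variable g : G.
Implicit Types (a b x y z : A) (l : R[i]).

Let tw_inner x y : A := star x ** y.
Let tw_lact a x : A := alpha g a ** x.

Lemma tw_inner_ract x y a : tw_inner x (y ** a) = tw_inner x y ** a.
Proof. exact: cmulA. Qed.
Lemma tw_inner_star x y : star (tw_inner x y) = tw_inner y x.
Proof. by rewrite starM starK. Qed.
Lemma tw_inner_ge0 x : exists b, tw_inner x x = star b ** b.
Proof. by exists x. Qed.
Lemma tw_inner_norm x : `|x| ^+ 2 = `|tw_inner x x|.
Proof. by rewrite cnorm_star. Qed.
Lemma tw_lactDl a b x : tw_lact (a + b) x = tw_lact a x + tw_lact b x.
Proof. by rewrite /tw_lact actD cmulDl. Qed.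
Lemma tw_lactZl l a x : tw_lact (l *: a) x = l *: tw_lact a x.
Proof. by rewrite /tw_lact actZ cmulZl. Qed.
Lemma tw_lactA a b x : tw_lact (a ** b) x = tw_lact a (tw_lact b x).
Proof. by rewrite /tw_lact act_mul cmulA. Qed.
Lemma tw_lact_adj a x y :
  tw_inner (tw_lact a x) y = tw_inner x (tw_lact (star a) y).
Proof. by rewrite /tw_inner /tw_lact starM act_star cmulA. Qed.

Definition twisted_fibre : hilbert_bimodule A :=
  @HilbertBimodule R A A tw_inner cmul tw_lact
    (@cmulDl R A) (@cmulDr R A) (@cmulZl R A) (fun l x a => cmulZr l x a)
    (@cmulA R A) (fun x => cmulDr (star x)) (fun l x => cmulZr l (star x))
    tw_inner_ract tw_inner_star tw_inner_ge0 tw_inner_norm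
    tw_lactDl tw_lactZl tw_lactA tw_lact_adj.

End Fibre.

Definition tw_mul (p q : oppg G) (x : twisted_fibre p) (y : twisted_fibre q) :
    twisted_fibre (p * q)%g :=
  Num.conj (omega q p) *: (alpha q x ** y).

Definition tw_unit (a : A) : twisted_fibre (1%g : oppg G) := a.

Local Notation elt := (existT (fun p : oppg G => twisted_fibre p : Type)).

Lemma tw_elt_eq p q (x y : A) : p = q -> x = y -> elt p x = elt q y.
Proof. by move=> -> ->. Qed.

Lemma tw_mulA (p q r : oppg G) (x : twisted_fibre p) (y : twisted_fibre q)
    (z : twisted_fibre r) : P p -> P q -> P r ->
  elt _ (tw_mul (tw_mul x y) z) = elt _ (tw_mul x (tw_mul y z)).
Proof.
move=> _ _ _; apply: tw_elt_eq; first by rewrite mulgA.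
rewrite /tw_mul actZ !cmulZl cmulZr !scalerA act_mul cmulA.
rewrite -!rmorphM [X in _ *: X]/= (actM alpha); congr (Num.conj _ *: _).
exact: esym (cocM omega r q p).
Qed.

Lemma coc1l g : omega 1%g g = 1.
Proof.
have /eqP := cocM omega 1%g 1%g g; rewrite !mul1g coc1 mulr1.
have w0 : omega 1%g g != 0 by rewrite -normr_gt0 coc_norm.
by rewrite -{1}[omega 1%g g]mulr1 (inj_eq (mulfI w0)) eq_sym => /eqP.
Qed.

Lemma coc1r g : omega g 1%g = 1.
Proof.
have /eqP := cocM omega g 1%g 1%g; rewrite !mulg1 coc1 mulr1.
have w0 : omega g 1%g != 0 by rewrite -normr_gt0 coc_norm.
by rewrite -{3}[omega g 1%g]mulr1 (inj_eq (mulfI w0)) => /eqP.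
Qed.

Lemma tw_mul_unitl (p : oppg G) a (x : twisted_fibre p) : P p ->
  elt _ (tw_mul (tw_unit a) x) = elt p (lact a x).
Proof.
move=> _; apply: tw_elt_eq; first by rewrite mul1g.
by rewrite /tw_mul coc1r conjC1 scale1r.
Qed.

Lemma tw_mul_unitr (p : oppg G) (x : twisted_fibre p) a : P p ->
  elt _ (tw_mul x (tw_unit a)) = elt p (ract x a).
Proof.
move=> _; apply: tw_elt_eq; first by rewrite mulg1.
by rewrite /tw_mul coc1l conjC1 scale1r act1.
Qed.

Lemma tw_mul_tensor (p q : oppg G) : P p -> P q -> p <> 1%g -> q <> 1%g ->
  induces_tensor_iso (@tw_mul p q).
Proof.
move=> _ _ _ _; split.
- move=> x y x' y'; rewrite /tw_mul /inner /lact /=.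
  rewrite starZ conjCK cmulZl cmulZr scalerA mulrC coc_conjK scale1r.
  by rewrite starM act_mul act_star !cmulA.
- move=> a x y; rewrite /tw_mul /lact /=.
  by rewrite cmulZr act_mul -(actM alpha) cmulA.
- by move=> x y a; rewrite /tw_mul /ract /= cmulZl cmulA.
- move=> w e e0; have [d [s ->] ds] := prod_lim_all w e0.
  exists [seq (alpha q^-1%g u.1, omega q p *: u.2) | u <- s].
  rewrite big_map; apply: le_trans ds; rewrite le_eqVlt; apply/orP; left.
  apply/eqP; congr (`|_ - _|); apply: eq_bigr => u _ /=.
  by rewrite /tw_mul cmulZr scalerA coc_conjK scale1r actVK.
Qed.

Lemma tw_unit_lact a b : lact a (tw_unit b) = tw_unit (a ** b).
Proof. by rewrite /lact /= act1. Qed.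

(** [X(alpha, omega)] over [P^op], that is over [P] as a subsemigroup of the opposite group. *)
Definition twisted_system : product_system A (opp_cone P) :=
  @ProductSystem R A (oppg G) (opp_cone P) twisted_fibre tw_mul tw_unit
    (fun _ _ => erefl) (fun _ _ => erefl)
    (Bijective (g := id) (fun=> erefl) (fun=> erefl))
    (fun _ _ => erefl) (fun _ _ => erefl) tw_unit_lact
    tw_mulA tw_mul_unitl tw_mul_unitr tw_mul_tensor.

End TwistedSystem.

(* Main.v *)
(** Compact operators on [X_p = A] are left multiplications, and [iota_p^r]
    sends the multiplication by [a] to that by [alpha_{r p^-1} (a)]. All left
    actions being injective, [Xtilde_q] is concentrated in the fibre over [q],
    so CNP-covariance only says that [psi^(p)] of the multiplication by [a]
    equals [psi_e (alpha_p^-1 (a))]; hence [x |-> iG(p)^* iA(x)] is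
    CNP-covariant. Conversely, in [NO_X] the covariance gives
    [j_p(x) star(j_p(y)) = j_e (alpha_p^-1 (x star(y)))], so that
    [j_p(x) b |-> j_e(x) b] extends to a unitary multiplier [U p]; these satisfy
    the relations of [omega] over [P], and since [G = P P^-1] they extend to
    [G]. The two homomorphisms obtained from the universal properties are
    mutually inverse, again by universality. *)

Require Import Defs.
From mathcomp Require Import all_boot all_order all_algebra.
From mathcomp Require Import complex.
From mathcomp Require Import all_classical all_reals all_analysis.

Set Implicit Arguments.
Unset Strict Implicit.
Unset Printing Implicit Defensive.

Import Order.TTheory GRing.Theory Num.Theory.
Import numFieldNormedType.Exports.

Local Open Scope classical_set_scope.
Local Open Scope complex_scope.
Local Open Scope ring_scope.
Local Open Scope cstar_scope.

(** * Limits by approximation in complete normed spaces *)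

Section Completeness.
Context {R : realType}.
Implicit Types e K : R[i].

Lemma norm_small_eq0 (V : normedModType R[i]) (x : V) K : 0 <= K ->
  (forall e, 0 < e -> e <= 1 -> `|x| <= K * e) -> x = 0.
Proof.
move=> K0 xK; apply/eqP; rewrite -normr_eq0 eq_le normr_ge0 andbT.
apply/ler_addgt0Pr => e e0; rewrite add0r.
have K1 : 0 < K + 1 by rewrite ltr_wpDl.
have d0 : 0 < e + (K + 1) by rewrite addr_gt0.
(* This test value is at most [1], as the hypothesis requires, and [K] times it is at most [e]. *)
apply: le_trans (xK (e / (e + (K + 1))) _ _) _.
- by rewrite divr_gt0.
- by rewrite ler_pdivrMr// mul1r lerDl ltW.
rewrite mulrA ler_pdivrMr// mulrC ler_pM2l//.
by rewrite addrCA lerDl addr_ge0// ltW.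
Qed.

Lemma closure_norm (V : normedModType R[i]) (D : set V) c : closure D c ->
  forall e, 0 < e -> exists2 d, D d & `|c - d| <= e.
Proof.
move=> Dc e e0.
have [d [Dd]] := Dc _ (nbhsx_ballx c e e0).
by rewrite -ball_normE /= => /ltW cd; exists d.
Qed.

(** [F e] plays the role of the admissible [e]-approximations of a limit not yet known. Sampling at
    [e = 2^-n] gives a Cauchy sequence, and letting [n] grow in the mutual estimate leaves the bound
    [e] for each member of [F e]. *)
Lemma complete_approx (V : completeNormedModType R[i]) (F : R[i] -> set V) :
  (forall e, 0 < e -> exists x, F e x) ->
  (forall e e' x y, 0 < e -> 0 < e' -> F e x -> F e' y ->
    `|x - y| <= e + e') ->
  exists l, forall e x, 0 < e -> F e x -> `|x - l| <= e.
Proof.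
move=> Fex Fle.
have p2 n : 0 < 2^-1 ^+ n :> R[i] by rewrite exprn_gt0// invr_gt0.
have [s sF] := choice (fun n => Fex _ (p2 n)).
have /cvg_ex[l sl] : cvg (s @ \oo).
  apply/cauchy_cvgP/cauchyP => e e0.
  have [n Hn] := pow2_small e0; exists (s n.+1); exists n.+2 => // m /= nm.
  rewrite -ball_normE /=; apply: le_lt_trans (Fle _ _ _ _ _ _ (sF _) (sF _)) _.
  - exact: p2.
  - exact: p2.
  apply: lt_le_trans (Hn n.+1 (leqnSn n)); rewrite mulr_natl mulr2n ltrD2l.
  by rewrite ltr_iXn2l ?invr_gt0// invf_lt1// ltrDl.
exists l => e x e0 Fx; apply/ler_addgt0Pr => d d0.
have d2 : 0 < d / 2 by rewrite divr_gt0.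
move/cvgrPdist_le : sl => /(_ _ d2)[n1 _ H1].
have [n2 H2] := pow2_small d0.
rewrite -(subrKA (s (maxn n1 n2))); apply: le_trans (ler_normD _ _) _.
have -> : e + d = (e + d / 2) + d / 2 by rewrite -addrA -splitr.
apply: lerD; last by rewrite distrC; apply: H1; rewrite /= leq_maxl.
apply: le_trans (Fle _ _ _ _ e0 (p2 _) Fx (sF _)) _; rewrite lerD2l.
by rewrite ler_pdivlMr// mulrC; apply: H2; rewrite leq_maxr.
Qed.

End Completeness.

(** * Cancellation without a unit *)

Section Cancellation.
Context {R : realType} {A : cstarAlgType R}.
Implicit Types a b c : A.

Lemma norm_cmul_star a : `|a ** star a| = `|a| ^+ 2.
Proof. by rewrite -{1}(starK a) cnorm_star norm_star. Qed.

Lemma cmul_star_eq0 a : a ** star a = 0 -> a = 0.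
Proof.
move=> a0; apply/eqP; rewrite -normr_eq0; have := norm_cmul_star a.
by rewrite a0 normr0 => /esym/eqP; rewrite expf_eq0.
Qed.

Lemma star_cmul_eq0 a : star a ** a = 0 -> a = 0.
Proof.
by rewrite -{2}(starK a) => /cmul_star_eq0 a0; rewrite -(starK a) a0 star0.
Qed.

(** The choice [c = star (a - b)] and the C*-identity take the place of a unit. *)
Lemma cmul_injr a b : (forall c, a ** c = b ** c) -> a = b.
Proof.
move=> ab; apply/eqP; rewrite -subr_eq0; apply/eqP/cmul_star_eq0.
by rewrite cmulBl ab subrr.
Qed.

Lemma cmul_injl a b : (forall c, c ** a = c ** b) -> a = b.
Proof.
move=> ab; rewrite -(starK a) -(starK b); congr star.
by apply: cmul_injr => c; rewrite -(starK c) -!starM ab.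
Qed.

Lemma starB a b : star (a - b) = star a - star b.
Proof. by rewrite starD starN. Qed.

End Cancellation.

(** * Boundedness of star-homomorphisms *)

Section HomBounded.
Context {R : realType}.
Implicit Types A B : cstarAlgType R.

Section HomTheory.
Context {A B : cstarAlgType R} {f : A -> B}.
Hypothesis hf : cstar_hom f.

Lemma homD a b : f (a + b) = f a + f b. Proof. by case: hf. Qed.
Lemma homZ (l : R[i]) a : f (l *: a) = l *: f a. Proof. by case: hf. Qed.
Lemma homM a b : f (a ** b) = f a ** f b. Proof. by case: hf. Qed.
Lemma hom_star a : f (star a) = star (f a). Proof. by case: hf. Qed.
Lemma homN a : f (- a) = - f a. Proof. by rewrite -scaleN1r homZ scaleN1r. Qed.
Lemma homB a b : f (a - b) = f a - f b. Proof. by rewrite homD homN. Qed.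
Lemma hom0 : f 0 = 0. Proof. by rewrite -(subrr (0 : A)) homB subrr. Qed.
Lemma hom_sum I (s : seq I) (F : I -> A) :
  f (\sum_(i <- s) F i) = \sum_(i <- s) f (F i).
Proof. by elim/big_rec2: _ => [|i y1 y2 _ <-]; rewrite ?hom0 ?homD. Qed.
End HomTheory.

(** [d] is [1 - (1 - a^2)^(1/2)], the fixed point of a contraction. *)
Lemma sqrt_fixpoint A (a : A) : star a = a -> `|a| <= 2^-1 ->
  exists d, [/\ star d = d, a ** d = d ** a & d + d = a ** a + d ** d].
Proof.
move=> sa a2.
have h0 : 0 <= 2^-1 :> R[i] by rewrite invr_ge0.
have hh x : 2^-1 *: (x + x) = x :> A.
  by rewrite -mulr2n -[x *+ 2]scaler_nat scalerA mulVf ?pnatr_eq0// scale1r.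
pose T (d : A) := 2^-1 *: (a ** a + d ** d).
(* [T] preserves [ok], and on it halves distances, because the factor [|d| + |d'|] is at most [1]
   there. *)
pose ok (d : A) := [/\ `|d| <= 2^-1, star d = d & a ** d = d ** a].
have okT d : ok d -> ok (T d).
  move=> [d2 sd ad]; split.
  - rewrite normrZ ger0_norm// -[leRHS]mulr1 ler_wpM2l//.
    apply: le_trans (ler_normD _ _) _; rewrite [leRHS]splitr mul1r.
    apply: lerD.
      apply: le_trans (cnormM _ _) _; rewrite -[leRHS]mulr1 ler_pM//.
      by apply: le_trans a2 _; rewrite invf_le1// ler1n.
    apply: le_trans (cnormM _ _) _; rewrite -[leRHS]mulr1 ler_pM//.
    by apply: le_trans d2 _; rewrite invf_le1// ler1n.
  - by rewrite starZ starD !starM sd sa fmorphV rmorph_nat.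
  - by rewrite cmulZr cmulZl cmulDl cmulDr -!cmulA -ad !cmulA ad.
have dT (d d' : A) : `|T d - T d'| <= 2^-1 * ((`|d| + `|d'|) * `|d - d'|).
  rewrite -scalerBr normrZ (ger0_norm h0) ler_wpM2l// opprD addrACA subrr add0r.
  have -> : d ** d - d' ** d' = d ** (d - d') + (d - d') ** d'.
    by rewrite cmulBr cmulBl addrA subrK.
  apply: le_trans (ler_normD _ _) _; rewrite mulrDl.
  by apply: lerD; first exact: cnormM; rewrite [leRHS]mulrC cnormM.
have dT2 d d' : ok d -> ok d' -> `|T d - T d'| <= 2^-1 * `|d - d'|.
  move=> [d2 _ _] [d'2 _ _]; apply: le_trans (dT _ _) _; rewrite ler_wpM2l//.
  rewrite ler_piMl//; apply: le_trans (lerD d2 d'2) _.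
  by rewrite [leRHS]splitr mul1r.
(* With contraction factor [1/2], a defect of [e / 2] puts a point within [e] of the fixed point. *)
pose F e := [set d | ok d /\ `|d - T d| <= 2^-1 * e].
have ok0 n : ok (iter n T 0).
  elim: n => [|n IH]; last exact: okT.
  by split; rewrite ?normr0 ?star0 ?cmul0l ?cmul0r.
have dn n : `|iter n T 0 - T (iter n T 0)| <= 2^-1 ^+ n.
  elim: n => [|n IH].
    rewrite sub0r normrN; have [le1 _ _] := okT _ (ok0 0).
    by apply: le_trans le1 _; rewrite expr0 invf_le1// ler1n.
  apply: le_trans (dT2 _ _ (ok0 _) (ok0 n.+1)) _.
  by rewrite exprS ler_wpM2l.
have [| |d Hd] := @complete_approx R A F.
- move=> e e0; have [n Hn] := pow2_small e0.
  exists (iter n T 0); split; first exact: ok0.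
  apply: le_trans (dn n) _; rewrite mulrC ler_pdivlMr// mulrC.
  exact: Hn.
- move=> e e' x y e0 e'0 [okx xT] [oky yT].
  have h : `|x - y| <= 2^-1 * (e + e') + 2^-1 * `|x - y|.
    rewrite -[X in `|X| <= _](subrKA (T x)) -[T x - y](subrKA (T y)).
    apply: le_trans (ler_normD _ _) _; rewrite mulrDr -[leRHS]addrA; apply: lerD => //.
    apply: le_trans (ler_normD _ _) _; rewrite [leLHS]addrC.
    apply: lerD; last exact: dT2.
    by rewrite distrC.
  have : 2^-1 * `|x - y| <= 2^-1 * (e + e').
    move: h; rewrite -lerBlDr; congr (_ <= _).
    by rewrite {1}[`|x - y|]splitr mulrC addrK.
  by rewrite ler_pM2l ?invr_gt0.
have near e : 0 < e -> exists2 x, F e x & `|x - d| <= e.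
  move=> e0; have [n Hn] := pow2_small e0.
  have Fx : F e (iter n T 0).
    split; first exact: ok0.
    apply: le_trans (dn n) _; rewrite mulrC ler_pdivlMr// mulrC.
    exact: Hn.
  by exists (iter n T 0); last exact: Hd.
exists d; split.
- apply/eqP; rewrite -subr_eq0; apply/eqP/(norm_small_eq0 (K := 2)) => // e e0 _.
  have [x [[_ sx _] _] xd] := near _ e0.
  have -> : star d - d = (x - d) - star (x - d) by rewrite starB sx opprB [RHS]addrC subrKA.
  apply: le_trans (ler_normB _ _) _.
  by rewrite norm_star mulr_natl mulr2n lerD.
- apply/eqP; rewrite -subr_eq0; apply/eqP/(norm_small_eq0 (K := 2)) => // e e0 _.
  have [x [[_ _ ax] _] xd] := near _ e0.
  have -> : a ** d - d ** a = (x - d) ** a - a ** (x - d).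
    by rewrite cmulBl cmulBr ax opprB [RHS]addrC subrKA.
  have a1 : `|a| <= 1 by apply: le_trans a2 _; rewrite invf_le1// ler1n.
  apply: le_trans (ler_normB _ _) _; rewrite mulr_natl mulr2n; apply: lerD.
    by apply: le_trans (cnormM _ _) _; rewrite -[leRHS]mulr1 ler_pM.
  by apply: le_trans (cnormM _ _) _; rewrite -[leRHS]mul1r ler_pM.
- suff dE : d = T d.
    by rewrite {1 2}dE /T -scalerDr hh.
  apply/eqP; rewrite -subr_eq0; apply/eqP.
  apply/(norm_small_eq0 (K := 2 + (1 + `|d|))) => [|e e0 _].
    by rewrite addr_ge0// addr_ge0.
  have [x [[x2 sx ax] xT] xd] := near _ e0.
  have -> : d - T d = (d - x) + (x - T x) + (T x - T d).
    by rewrite !subrKA.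
  apply: le_trans (ler_normD _ _) _; rewrite mulrDl; apply: lerD.
    apply: le_trans (ler_normD _ _) _; rewrite mulr_natl mulr2n.
    apply: lerD; first by rewrite distrC.
    apply: le_trans xT _; rewrite -[leRHS]mul1r ler_pM2r//.
    by rewrite invf_le1// ler1n.
  apply: le_trans (dT _ _) _; rewrite -[leRHS]mul1r ler_pM// ?mulr_ge0 ?addr_ge0//.
    by rewrite invf_le1// ler1n.
  rewrite ler_pM ?addr_ge0// lerD2r; apply: le_trans x2 _.
  by rewrite invf_le1// ler1n.
Qed.

(** [1 + ('i *: a - d)] is a unitary with imaginary part [a]; its image is
    unitary as well, which bounds the image of [a]. *)
Lemma hom_bounded_sa A B (f : A -> B) : cstar_hom f ->
  forall a, star a = a -> `|a| <= 2^-1 -> `|f a| <= 2.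
Proof.
move=> hf a sa a2; have [d [sd ad dd]] := sqrt_fixpoint sa a2.
have [y yE [yy yd sy]] : exists2 y, y = 'i *: a
    & [/\ y ** y = - (a ** a), y ** d = d ** y & star y = - y].
  exists ('i *: a) => //; split.
  - by rewrite cmulZl cmulZr scalerA -expr2 sqrCi scaleN1r.
  - by rewrite cmulZl cmulZr ad.
  - by rewrite starZ sa conjCi scaleNr.
pose E := y - d.
have sEE : star E = - y - d by rewrite starB sy sd.
(* Unitarity of [1 + E] written without the unit. Any homomorphism preserves it, and the C*-identity
   turns it into the bound [2] on the image of [E]. *)
have sE : star E ** E = - (E + star E).
  rewrite sEE cmulBl !cmulBr !cmulNl yy yd !opprK opprB.
  rewrite -[LHS]addrA [_ ** y + _]addrCA subrr addr0 -dd.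
  by rewrite /E [y - d + _]addrACA subrr add0r opprD opprK.
have fE : `|f E| <= 2.
  have [->|E0] := eqVneq (f E) 0; first by rewrite normr0.
  rewrite -(ler_pM2r (x := `|f E|)) ?normr_gt0 // -expr2 -cnorm_star.
  rewrite -(hom_star hf) -(homM hf) sE (homN hf) normrN (homD hf).
  apply: le_trans (ler_normD _ _) _.
  by rewrite (hom_star hf) norm_star mulr_natl mulr2n.
have aE : a = (- 'i / 2) *: (E - star E).
  rewrite sEE /E opprD !opprK addrACA addNr addr0.
  have -> : y + y = (2 : R[i]) *: y by rewrite scaler_nat mulr2n.
  rewrite (scalerA (- 'i / 2) 2 y) divfK ?pnatr_eq0// yE scalerA.
  by rewrite mulNr -expr2 sqrCi opprK scale1r.
rewrite aE (homZ hf) normrZ (homB hf) (hom_star hf).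
rewrite normrM normrN normCi mul1r normfV normr_nat mulrC ler_pdivrMr//.
apply: le_trans (ler_normB _ _) _; rewrite norm_star mulr_natr mulr2n.
exact: lerD.
Qed.

(** Scaling the self-adjoint case gives the constant [4]; applied to [star a ** a] it becomes [2]
    after a square root. Continuity is all that the density arguments below use. *)
Lemma hom_bounded A B (f : A -> B) : cstar_hom f ->
  forall a, `|f a| <= 2 * `|a|.
Proof.
move=> hf.
have bsa a : star a = a -> `|f a| <= 2 * 2 * `|a|.
  move=> sa; have [->|a0] := eqVneq a 0; first by rewrite (hom0 hf) !normr0 mulr0.
  have n0 : 0 < `|a| by rewrite normr_gt0.
  have l0 : 0 < (2 * `|a|)^-1 by rewrite invr_gt0 mulr_gt0.
  have := @hom_bounded_sa A B f hf ((2 * `|a|)^-1 *: a).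
  rewrite starZ sa conj_Creal ?gtr0_real// (homZ hf) !normrZ !gtr0_norm//.
  rewrite invfM mulfVK ?gt_eqF// => /(_ erefl (lexx _)).
  by rewrite -invfM mulrC ler_pdivrMr ?mulr_gt0// mulrA.
move=> a; rewrite -(ler_pXn2r (n := 2)) ?nnegrE ?mulr_ge0//.
rewrite -cnorm_star -(hom_star hf) -(homM hf).
apply: le_trans (bsa _ _) _; first by rewrite starM starK.
by rewrite cnorm_star exprMn expr2.
Qed.

End HomBounded.

(** * Closed right ideals generated by a family *)

Section ModuleApproximation.
Context {R : realType} {B : cstarAlgType R} {I : Type}.
Implicit Types (f : I -> B) (b c d : B) (e : R[i]).

(** Membership in the closed right ideal generated by the values of [f]; for a homomorphism [f],
    holding for all [c] it expresses nondegeneracy. *)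
Definition approximable f c := forall e, 0 < e ->
  exists s : seq (I * B), `|c - \sum_(u <- s) f u.1 ** u.2| <= e.

Lemma approximable_lim f c :
  (forall e, 0 < e -> exists2 d, approximable f d & `|c - d| <= e) ->
  approximable f c.
Proof.
move=> fc e e0; have e2 : 0 < e / 2 by rewrite divr_gt0.
have [d fd cd] := fc _ e2; have [s ds] := fd _ e2.
exists s; rewrite -(subrKA d) (splitr e).
by apply: le_trans (ler_normD _ _) _; apply: lerD.
Qed.

Lemma approximable_gen f i b : approximable f (f i ** b).
Proof.
by move=> e e0; exists [:: (i, b)]; rewrite big_seq1 subrr normr0 ltW.
Qed.

Lemma approximableD f c d :
  approximable f c -> approximable f d -> approximable f (c + d).
Proof.
move=> fc fd e e0; have e2 : 0 < e / 2 by rewrite divr_gt0.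
have [s cs] := fc _ e2; have [t dt] := fd _ e2.
exists (s ++ t); rewrite big_cat opprD addrACA (splitr e).
by apply: le_trans (ler_normD _ _) _; apply: lerD.
Qed.

Lemma approximable0 f : approximable f 0.
Proof. by move=> e e0; exists [::]; rewrite big_nil subrr normr0 ltW. Qed.

Lemma approximable_sum f J (s : seq J) (F : J -> B) :
  (forall k, approximable f (F k)) -> approximable f (\sum_(k <- s) F k).
Proof.
move=> fF; elim/big_ind: _ => //; first exact: approximable0.
by move=> c d; exact: approximableD.
Qed.

Lemma approximableM f c d : approximable f c -> approximable f (c ** d).
Proof.
move=> fc; apply: approximable_lim => e e0.
have d1 : 0 < `|d| + 1 by rewrite ltr_wpDl.
have [s cs] := fc _ (divr_gt0 e0 d1).
exists ((\sum_(u <- s) f u.1 ** u.2) ** d).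
  elim: {cs} s => [|u s IH]; first by rewrite big_nil cmul0l; exact: approximable0.
  rewrite big_cons cmulDl; apply: approximableD => //.
  by rewrite -cmulA; exact: approximable_gen.
rewrite -cmulBl; apply: le_trans (cnormM _ _) _.
apply: le_trans (_ : e / (`|d| + 1) * (`|d| + 1) <= e); last by rewrite divfK ?gt_eqF.
by apply: ler_pM => //; rewrite lerDl.
Qed.

Lemma approximableZ f l c : approximable f c -> approximable f (l *: c).
Proof.
move=> fc; apply: approximable_lim => e e0.
have d1 : 0 < `|l| + 1 by rewrite ltr_wpDl.
have [s cs] := fc _ (divr_gt0 e0 d1).
exists (l *: (\sum_(u <- s) f u.1 ** u.2)).
  rewrite scaler_sumr; apply: approximable_sum => u.
  by rewrite -cmulZr; exact: approximable_gen.
rewrite -scalerBr normrZ mulrC.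
apply: le_trans (_ : e / (`|l| + 1) * (`|l| + 1) <= e); last by rewrite divfK ?gt_eqF.
by apply: ler_pM => //; rewrite lerDl.
Qed.

(** The tool for identities between bounded operators: [F] is the difference of the two sides, so
    that only the generators [f i ** b] need a computation. *)
Lemma approximable_eq0 f (V : normedModType R[i]) (F : B -> V) (K : R[i]) :
  (forall c, approximable f c) ->
  (forall c d, F (c + d) = F c + F d) ->
  0 <= K -> (forall c, `|F c| <= K * `|c|) ->
  (forall i b, F (f i ** b) = 0) -> forall c, F c = 0.
Proof.
move=> fall FD K0 FK F0 c; apply: (norm_small_eq0 K0) => e e0 _.
have [s cs] := fall c _ e0.
have Fs : F (\sum_(u <- s) f u.1 ** u.2) = 0.
  elim: {cs} s => [|u s IH]; last by rewrite big_cons FD F0 IH addr0.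
  by rewrite big_nil; apply: (addrI (F 0)); rewrite -FD !addr0.
rewrite -[c](subrK (\sum_(u <- s) f u.1 ** u.2)) FD Fs addr0.
by apply: le_trans (FK _) _; rewrite ler_wpM2l.
Qed.

End ModuleApproximation.

(** * Algebra of multipliers *)

Section Multipliers.
Context {R : realType} {B : cstarAlgType R}.
Implicit Types (m n : multiplier B) (x y z : B) (l : R[i]).

Lemma mult_adjP m x y : star (m x) ** y = star x ** mult_adj m y.
Proof. by case: m. Qed.

Lemma mult_adjPV m x y : star (mult_adj m x) ** y = star x ** m y.
Proof. by rewrite -[y in LHS]starK -starM -mult_adjP starM starK. Qed.

(** The value of [m] is recovered from its products with elements of [B], which the adjoint
    computes. Additivity, homogeneity and right [B]-linearity of multipliers all follow from
    this. *)
Lemma mult_eq m x y : (forall z, star (mult_adj m z) ** x = star z ** y) ->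
  m x = y.
Proof.
by move=> h; apply: cmul_injl => z; rewrite -(starK z) -mult_adjPV h.
Qed.

Definition mult_star m : multiplier B := Multiplier (mult_adjPV m).

Lemma multM m x y : m (x ** y) = m x ** y.
Proof. by apply: mult_eq => z; rewrite !cmulA mult_adjPV. Qed.

Lemma multD m x y : m (x + y) = m x + m y.
Proof. by apply: mult_eq => z; rewrite !cmulDr !mult_adjPV. Qed.

Lemma multZ m l x : m (l *: x) = l *: m x.
Proof. by apply: mult_eq => z; rewrite !cmulZr !mult_adjPV. Qed.

Lemma mult_adjM m x y : mult_adj m (x ** y) = mult_adj m x ** y.
Proof. exact: (multM (mult_star m)). Qed.

Lemma mult_adjD m x y : mult_adj m (x + y) = mult_adj m x + mult_adj m y.
Proof. exact: (multD (mult_star m)). Qed.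

Lemma mult_adjZ m l x : mult_adj m (l *: x) = l *: mult_adj m x.
Proof. exact: (multZ (mult_star m)). Qed.

Lemma mult_unitary_star m : mult_unitary m -> mult_unitary (mult_star m).
Proof. by case. Qed.

Lemma mult_unitary_norm m x : mult_unitary m -> `|m x| = `|x|.
Proof.
move=> [mK _]; apply/eqP; rewrite -(eqrXn2 (n := 2))//.
by rewrite -!cnorm_star mult_adjP mK.
Qed.

Lemma mult_unitary_adj_norm m x : mult_unitary m -> `|mult_adj m x| = `|x|.
Proof. by move=> /mult_unitary_star um; exact: (mult_unitary_norm x um). Qed.

Lemma mult_comp_adjP m n x y :
  star (m (n x)) ** y = star x ** mult_adj n (mult_adj m y).
Proof. by rewrite !mult_adjP. Qed.

Definition mult_comp m n : multiplier B := Multiplier (mult_comp_adjP m n).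

Lemma mult_scale_adjP l m x y :
  star (l *: m x) ** y = star x ** (Num.conj l *: mult_adj m y).
Proof. by rewrite starZ cmulZl mult_adjP cmulZr. Qed.

Definition mult_scale l m : multiplier B := Multiplier (mult_scale_adjP l m).

Lemma mult_unitary_comp m n :
  mult_unitary m -> mult_unitary n -> mult_unitary (mult_comp m n).
Proof.
by move=> [mK mK'] [nK nK']; split=> b /=; rewrite ?mK ?nK ?nK' ?mK'.
Qed.

Lemma mult_unitary_scale l m :
  `|l| = 1 -> mult_unitary m -> mult_unitary (mult_scale l m).
Proof.
move=> l1 [mK mK']; have ll : Num.conj l * l = 1.
  by rewrite mulrC -normCK l1 expr1n.
split=> b /=; rewrite ?mult_adjZ ?multZ scalerA ?mK ?mK'.
  by rewrite ll scale1r.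
by rewrite mulrC ll scale1r.
Qed.

End Multipliers.

(** * Unitary multipliers from inner-product preserving families *)

Section UnitaryExtension.
Context {R : realType} {B : cstarAlgType R} {I : Type}.
Implicit Types (f g : I -> B) (c d : B).

Let sum f (s : seq (I * B)) := \sum_(u <- s) f u.1 ** u.2.

(** The closure of the graph of [sum f s |-> sum g s]. It is a relation because different sums may
    have the same value; single-valuedness comes later from [extends_inj]. *)
Definition extends f g c d := forall e : R[i], 0 < e ->
  exists s, `|c - sum f s| <= e /\ `|d - sum g s| <= e.

Section Isometry.
Variables f g : I -> B.
Hypothesis fg : forall i k, star (f i) ** f k = star (g i) ** g k.

Lemma sum_inner s t : star (sum f s) ** sum f t = star (sum g s) ** sum g t.
Proof.
elim: s => [|u s IHs]; first by rewrite /sum !big_nil star0 !cmul0l.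
rewrite /sum !big_cons !starD !cmulDl -!/(sum _ _) IHs; congr (_ + _).
elim: t {IHs} => [|v t IHt]; first by rewrite /sum !big_nil !cmul0r.
rewrite /sum !big_cons !cmulDr -!/(sum _ _) IHt; congr (_ + _).
by rewrite !starM -!cmulA; congr (_ ** _); rewrite !cmulA fg.
Qed.

Lemma sum_dist s t : `|sum f s - sum f t| = `|sum g s - sum g t|.
Proof.
apply/eqP; rewrite -(eqrXn2 (n := 2))//; apply/eqP.
by rewrite -!cnorm_star !starB !cmulBl !cmulBr !sum_inner.
Qed.

(** By [sum_dist], the [g]-sums are as close to one another as the [f]-sums that approximate [c], so
    completeness provides the limit. *)
Lemma extends_total c : approximable f c -> exists d, extends f g c d.
Proof.
move=> fc.
pose F e := [set d | exists2 s, `|c - sum f s| <= e & d = sum g s].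
have Fex e : 0 < e -> exists d, F e d.
  by move=> e0; have [s cs] := fc _ e0; exists (sum g s), s.
have [|d Hd] := @complete_approx R B F Fex.
  move=> e e' _ _ e0 e'0 [s cs ->] [t ct ->]; rewrite -sum_dist -(subrKA c).
  by apply: le_trans (ler_normD _ _) _; apply: lerD; rewrite // distrC.
exists d => e e0; have [s cs] := fc _ e0.
by exists s; split=> //; rewrite distrC; apply: Hd => //; exists s.
Qed.

Lemma extends_inner c d c' d' : extends f g c d -> extends f g c' d' ->
  star c ** c' = star d ** d'.
Proof.
move=> cd cd'; apply/eqP; rewrite -subr_eq0; apply/eqP.
(* One summand for each replacement of a product by its approximant; the [1] bounds the growth of
   the norm of an approximant, since [e <= 1]. *)
pose K := (`|c'| + (`|c| + 1)) + (`|d'| + (`|d| + 1)).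
have K0 : 0 <= K by rewrite !addr_ge0.
apply: (norm_small_eq0 K0) => e e0 e1.
have [s [cs ds]] := cd _ e0; have [t [ct dt]] := cd' _ e0.
have close (x y v w : B) : `|x - v| <= e -> `|y - w| <= e ->
    `|star x ** y - star v ** w| <= (`|y| + (`|x| + 1)) * e.
  move=> xv yw; rewrite -(subrKA (star v ** y)) -cmulBl -cmulBr -starB.
  apply: le_trans (ler_normD _ _) _; rewrite mulrDl; apply: lerD.
    by apply: le_trans (cnormM _ _) _; rewrite norm_star mulrC ler_wpM2l.
  apply: le_trans (cnormM _ _) _; rewrite norm_star ler_pM//.
  rewrite -[v](subrK x); apply: le_trans (ler_normD _ _) _.
  by rewrite addrC lerD2l distrC; apply: le_trans xv _.
rewrite -(subrKA (star (sum f s) ** sum f t)).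
apply: le_trans (ler_normD _ _) _; rewrite mulrDl; apply: lerD; first exact: close.
by rewrite sum_inner distrC; exact: close.
Qed.

Lemma extends_sym c d : extends f g c d -> extends g f d c.
Proof. by move=> cd e /cd[s [cs ds]]; exists s. Qed.

(** All four products in the expansion of [star (c - c') ** (c - c')] equal [star d ** d], so they
    cancel. *)
Lemma extends_inj c c' d : extends f g c d -> extends f g c' d -> c = c'.
Proof.
move=> cd cd'; apply/eqP; rewrite -subr_eq0; apply/eqP/star_cmul_eq0.
rewrite starB cmulBl !cmulBr.
rewrite (extends_inner cd cd) (extends_inner cd cd').
by rewrite (extends_inner cd' cd) (extends_inner cd' cd') !subrr.
Qed.

End Isometry.

(** The extension from [g] back to [f] serves both as adjoint and as inverse: [extends_inner] is the
    adjoint relation and [extends_inj] gives the two inverse laws. *)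
Lemma unitary_extension f g :
  (forall i k, star (f i) ** f k = star (g i) ** g k) ->
  (forall c, approximable f c) -> (forall c, approximable g c) ->
  exists m : multiplier B, mult_unitary m /\
    forall i b, m (f i ** b) = g i ** b.
Proof.
move=> fg fall gall.
have gf i k : star (g i) ** g k = star (f i) ** f k by rewrite fg.
have [m mP] := choice (fun c => extends_total fg (fall c)).
have [n nP] := choice (fun c => extends_total gf (gall c)).
have nP' d : extends f g (n d) d by exact: extends_sym.
have adj x y : star (m x) ** y = star x ** n y.
  by rewrite (extends_inner fg (mP x) (nP' y)).
exists (Multiplier adj); split.
  split=> b /=; first exact: (extends_inj fg (nP' (m b)) (mP b)).
  exact: (extends_inj gf (extends_sym (mP (n b))) (nP b)).
move=> i b; apply: (extends_inj gf (extends_sym (mP _))) => e e0.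
by exists [:: (i, b)]; rewrite /sum !big_seq1 !subrr normr0 ltW.
Qed.

End UnitaryExtension.

(** * From the fibres of a representation to a covariant pair *)

Section CovariantExtension.
Context {R : realType} {G : groupType} {A N : cstarAlgType R}.
Variables (alpha : cstar_action G A) (omega : cocycle R G) (P : set G).
Hypotheses (P1 : P 1%g) (PM : forall p q, P p -> P q -> P (p * q)%g).
Hypotheses (Pdir : directed P) (Pgen : generated_by P).
Variable J : G -> A -> N.
Hypothesis JD : forall p x y, P p -> J p (x + y) = J p x + J p y.
Hypothesis JZ : forall p l x, P p -> J p (l *: x) = l *: J p x.
Hypothesis JM : forall p q x y, P p -> P q ->
  J (q * p)%g (Num.conj (omega q p) *: (alpha q x ** y)) = J p x ** J q y.
Hypothesis J1 : cstar_hom (J 1%g).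
Hypothesis J_inner : forall p x y, P p ->
  J 1%g (star x ** y) = star (J p x) ** J p y.
Hypothesis J_rank_one : forall p x y, P p ->
  J p x ** star (J p y) = J 1%g (alpha p^-1%g (x ** star y)).
Hypothesis Jgen : generates [set b | exists p x, P p /\ b = J p x].

Implicit Types (p q r g h : G) (a x y : A) (b c d : N).

Local Notation pi := (J 1%g).

Lemma coc_normK g h : omega g h * Num.conj (omega g h) = 1.
Proof. by rewrite mulrC coc_conjK. Qed.

Lemma J_actl p a x : P p -> pi a ** J p x = J p (alpha p a ** x).
Proof. by move=> Pp; rewrite -JM// mulg1 coc1r rmorph1 scale1r. Qed.

Lemma J_actr p x a : P p -> J p x ** pi a = J p (x ** a).
Proof. by move=> Pp; rewrite -JM// mul1g coc1l rmorph1 scale1r act1. Qed.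

Lemma J_norm p x : P p -> `|J p x| <= 2 * `|x|.
Proof.
move=> Pp; rewrite -(ler_pXn2r (n := 2)) ?nnegrE ?mulr_ge0//.
rewrite -cnorm_star -J_inner//; apply: le_trans (hom_bounded J1 _) _.
by rewrite cnorm_star exprMn expr2 -!mulrA ler_pM2l// ler_peMl ?exprn_ge0// ler1n.
Qed.

Lemma JB p x y : P p -> J p (x - y) = J p x - J p y.
Proof. by move=> Pp; rewrite JD// -scaleN1r JZ// scaleN1r. Qed.

Lemma J_sum p K (s : seq K) (F : K -> A) : P p ->
  J p (\sum_(k <- s) F k) = \sum_(k <- s) J p (F k).
Proof.
move=> Pp; elim: s => [|k s IH]; last by rewrite !big_cons JD// IH.
by rewrite !big_nil -(subrr (0 : A)) JB// subrr.
Qed.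

Lemma products_approximable a : approximable (@id A) a.
Proof.
by move=> e e0; have [_ [s ->] ad] := prod_lim_all a e0; exists s.
Qed.

(** Products are dense in [A], so [x] may be taken to be a product, from which one factor can be
    split off as an element of another fibre. The map [F] will be the identity or [star]. *)
Lemma J_approximable (I : Type) (f : I -> N) (F : N -> N) p x : P p ->
  (forall c d, F (c + d) = F c + F d) -> (forall c, `|F c| = `|c|) ->
  (forall u v, approximable f (F (J p (u ** v)))) -> approximable f (F (J p x)).
Proof.
move=> Pp FD Fn fF; apply: approximable_lim => e e0.
have e2 : 0 < e / 2 by rewrite divr_gt0.
have F0 : F 0 = 0 by apply: (addrI (F 0)); rewrite -FD !addr0.
have FB c d : F c - F d = F (c - d).
  by apply: (addIr (F d)); rewrite subrK -FD subrK.
have [_ [s ->] xs] := prod_lim_all x e2.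
exists (F (J p (\sum_(u <- s) u.1 ** u.2))).
  rewrite J_sum//; elim: s {xs} => [|u s IH].
    by rewrite big_nil F0; exact: approximable0.
  by rewrite big_cons FD; exact: approximableD.
rewrite FB Fn -JB//; apply: le_trans (J_norm _ Pp) _.
by rewrite mulrC -ler_pdivlMr.
Qed.

Lemma pi_approximable c : approximable pi c.
Proof.
(* A closed right ideal need not be self-adjoint; imposing the condition on [star c] too makes [D] a
   C*-subalgebra, so it is enough to treat the generators. *)
pose D := [set c | approximable pi c /\ approximable pi (star c)].
suff : D = setT by move/seteqP => [_ /(_ c I)[]].
apply: Jgen; first split.
- move=> d Dd; split; apply: approximable_lim => e e0.
    by have [d' [Dd' _] dd'] := closure_norm Dd e0; exists d'.
  have [d' [_ Dd'] dd'] := closure_norm Dd e0; exists (star d') => //.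
  by rewrite -starB norm_star.
- split.
  + by rewrite /D /= star0; split; exact: approximable0.
  + by move=> a b [? ?] [? ?]; rewrite /D /= starD; split; exact: approximableD.
  + by move=> l a [? ?]; rewrite /D /= starZ; split; exact: approximableZ.
- by move=> a b [? ?] [? ?]; rewrite /D /= starM; split; exact: approximableM.
- by move=> a [? ?]; rewrite /D /= starK.
- move=> _ [p [x [Pp ->]]]; split.
    apply: (J_approximable (F := id)) => // u v.
    rewrite -(actVK alpha p u) -J_actl//; exact: approximable_gen.
  apply: (J_approximable (F := star)) => // [a b|a|u v].
  - exact: starD.
  - exact: norm_star.
  - by rewrite -J_actr// starM -(hom_star J1); exact: approximable_gen.
Qed.

(** Here covariance enters: by [J_rank_one], [pi (v ** w)] lies in the right ideal generated by the
    fibre over [p], and [pi] is already nondegenerate. *)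
Lemma fibre_approximable p c : P p -> approximable (J p) c.
Proof.
move=> Pp; apply: approximable_lim => e e0.
have [s cs] := pi_approximable c e0.
exists (\sum_(u <- s) pi u.1 ** u.2) => //; apply: approximable_sum => u.
apply: approximableM; apply: (J_approximable (F := id)) => // v w.
have -> : v ** w = alpha p^-1%g (alpha p v ** star (star (alpha p w))).
  by rewrite starK -act_mul -actM mulVg act1.
by rewrite -J_rank_one//; exact: approximable_gen.
Qed.

(** The families [J p] and [pi] have the same inner products, namely [pi (star x ** y)], and both
    generate [N]. *)
Lemma fibre_unitaries : exists U : G -> multiplier N, forall p, P p ->
  mult_unitary (U p) /\ forall x b, U p (J p x ** b) = pi x ** b.
Proof.
suff /choice[U HU] : forall p, exists m : multiplier N, P p ->
    mult_unitary m /\ forall x b, m (J p x ** b) = pi x ** b by exists U.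
move=> p; have [Pp|nPp] := pselect (P p); last first.
  (* Outside [P] nothing is required; extending [pi] to itself supplies some multiplier. *)
  have [m _] := unitary_extension (f := pi) (fun _ _ => erefl)
    pi_approximable pi_approximable.
  by exists m.
have JJ x y : star (J p x) ** J p y = star (pi x) ** pi y.
  by rewrite -J_inner// (homM J1) (hom_star J1).
have [m Hm] := unitary_extension JJ (fun c => fibre_approximable c Pp)
  pi_approximable.
by exists m.
Qed.

Section FibreUnitaries.
Variable U : G -> multiplier N.
Hypothesis U_unitary : forall p, P p -> mult_unitary (U p).
Hypothesis UJ : forall p x b, P p -> U p (J p x ** b) = pi x ** b.

Local Notation V p := (mult_adj (U p)).

Lemma fibre_adjK p b : P p -> V p (U p b) = b.
Proof. by move=> /U_unitary[]. Qed.

Lemma fibre_unitaryK p b : P p -> U p (V p b) = b.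
Proof. by move=> /U_unitary[]. Qed.

Lemma fibre_adj_pi p x : P p -> V p (pi x) = J p x.
Proof.
by move=> Pp; apply: cmul_injr => b; rewrite -mult_adjM -(@UJ p x b Pp) fibre_adjK.
Qed.

Lemma fibre_adj_norm p b : P p -> `|V p b| = `|b|.
Proof. by move=> /U_unitary; exact: mult_unitary_adj_norm. Qed.

Lemma fibre_adj_J p q x : P p -> P q ->
  V q (J p x) = Num.conj (omega p q) *: J (p * q)%g x.
Proof.
move=> Pp Pq; have Ppq := PM Pp Pq.
apply/eqP; rewrite -subr_eq0; apply/eqP.
pose F x := V q (J p x) - Num.conj (omega p q) *: J (p * q)%g x.
apply: (approximable_eq0 (F := F) (K := 2 + 2) products_approximable).
- by move=> u v; rewrite /F !JD// mult_adjD scalerDr opprD addrACA.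
- by [].
- move=> u; apply: le_trans (ler_normB _ _) _; rewrite mulrDl; apply: lerD.
    by rewrite fibre_adj_norm ?J_norm.
  by rewrite normrZ norm_conjC coc_norm mul1r J_norm.
- move=> u v; apply/eqP; rewrite subr_eq0 -JZ//.
  (* On a product, [J p (u ** v)] is [pi] of [alpha p^-1 u] times [J p v]; the adjoint turns the
     first factor into one of the fibre over [q], and [JM] multiplies the two. *)
  by rewrite -{1}(actVK alpha p u) -J_actl// mult_adjM fibre_adj_pi// -JM// actVK.
Qed.

Lemma fibre_unitary1 b : U 1%g b = b.
Proof.
suff V1 c : V 1%g c = c by rewrite -{1}(V1 b) fibre_unitaryK.
apply/eqP; rewrite -subr_eq0; apply/eqP.
apply: (approximable_eq0 (F := fun c => V 1%g c - c) (K := 2) pi_approximable).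
- by move=> u v; rewrite mult_adjD opprD addrACA.
- by [].
- move=> u; apply: le_trans (ler_normB _ _) _.
  by rewrite mulr_natl mulr2n fibre_adj_norm.
- by move=> x d; rewrite mult_adjM fibre_adj_pi// subrr.
Qed.

(** The adjoints have known values on the range of [pi], so the adjoint relation is proved there by
    density and then inverted. [fibre_unitary_cov] is proved in the same way. *)
Lemma fibre_unitaryM p q b : P p -> P q -> U p (U q b) = omega p q *: U (p * q)%g b.
Proof.
move=> Pp Pq; have Ppq := PM Pp Pq.
suff VV c : V q (V p c) = Num.conj (omega p q) *: V (p * q)%g c.
  rewrite -{1}(fibre_adjK b Ppq) -[V _ (U _ b)]scale1r -(coc_normK p q) -scalerA -VV.
  by rewrite !multZ !fibre_unitaryK.
apply/eqP; rewrite -subr_eq0; apply/eqP.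
pose F c := V q (V p c) - Num.conj (omega p q) *: V (p * q)%g c.
apply: (approximable_eq0 (F := F) (K := 2) pi_approximable).
- by move=> u v; rewrite /F !mult_adjD scalerDr opprD addrACA.
- by [].
- move=> u; apply: le_trans (ler_normB _ _) _.
  by rewrite normrZ norm_conjC coc_norm mul1r !fibre_adj_norm// mulr_natl mulr2n.
- move=> x d; rewrite /F !mult_adjM !fibre_adj_pi// fibre_adj_J//.
  by rewrite cmulZl subrr.
Qed.

Lemma fibre_unitary_cov p a b : P p -> U p (pi a ** b) = pi (alpha p a) ** U p b.
Proof.
move=> Pp; suff VV c : V p (pi (alpha p a) ** c) = pi a ** V p c.
  by rewrite -{1}(fibre_adjK b Pp) -VV fibre_unitaryK.
apply/eqP; rewrite -subr_eq0; apply/eqP.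
pose F c := V p (pi (alpha p a) ** c) - pi a ** V p c.
apply: (approximable_eq0 (F := F) (K := `|pi (alpha p a)| + `|pi a|) pi_approximable).
- by move=> u v; rewrite /F cmulDr !mult_adjD cmulDr opprD addrACA.
- by rewrite addr_ge0.
- move=> u; apply: le_trans (ler_normB _ _) _; rewrite mulrDl.
  rewrite fibre_adj_norm//; apply: lerD; first exact: cnormM.
  by apply: le_trans (cnormM _ _) _; rewrite fibre_adj_norm.
- move=> x d; apply/eqP; rewrite subr_eq0 cmulA -(homM J1) !mult_adjM !fibre_adj_pi//.
  by rewrite cmulA J_actl.
Qed.

(** The fractions [p q^-1] form a subgroup containing [P]: inverses exchange numerator and
    denominator, and directedness is the Ore condition needed for products. *)
Lemma exists_denominator g : exists q, P q /\ P (g * q)%g.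
Proof.
pose K := [set g | exists q, P q /\ P (g * q)%g].
suff : K = setT by move/seteqP => [_ /(_ g I)].
apply: Pgen.
- by exists 1%g; rewrite mulg1.
- move=> h k [q [Pq Phq]] [r [Pr Pkr]].
  have [t [Pt qt krt]] := Pdir Pq Pkr.
  (* This denominator is [k^-1 t]; hence [h k] times it is [h t], which is [h q] times [q^-1 t]. *)
  exists (r * ((k * r)^-1 * t))%g; split; first exact: PM.
  rewrite -mulgA (mulgA k) mulVKg -(mulVKg q t) mulgA; exact: PM.
- by move=> k [q [Pq Pkq]]; exists (k * q)%g; rewrite mulKg.
- by move=> p Pp; exists 1%g; rewrite mulg1.
Qed.

Definition intertwines g (m : multiplier N) q :=
  forall b, m (U q b) = omega g q *: U (g * q)%g b.

(** The cocycle identity makes the condition insensitive to enlarging the denominator; having both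
    directions allows passage between two denominators through a common upper bound. *)
Lemma intertwines_mulr g m q t : P q -> P (g * q)%g -> P t ->
  intertwines g m q <-> intertwines g m (q * t)%g.
Proof.
move=> Pq Pgq Pt; split=> mq b.
  rewrite -[U (q * t)%g b]scale1r -(coc_conjK omega q t) -scalerA.
  rewrite -(fibre_unitaryM _ Pq Pt) multZ mq.
  rewrite fibre_unitaryM// !scalerA -mulrA [omega g q * _]mulrC cocM.
  by rewrite mulrCA coc_conjK mulr1 mulgA.
rewrite -(fibre_unitaryK b Pt) fibre_unitaryM// multZ mq fibre_unitaryM//.
by rewrite !scalerA [omega q t * _]mulrC -cocM mulrC mulgA.
Qed.

Lemma group_unitary g : exists m : multiplier N, mult_unitary m /\
  forall q, P q -> P (g * q)%g -> intertwines g m q.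
Proof.
have [q [Pq Pgq]] := exists_denominator g.
(* The value forced by the denominator [q]; any other denominator [r] is compared with it at a
   common upper bound [t]. *)
exists (mult_scale (omega g q) (mult_comp (U (g * q)%g) (mult_star (U q)))).
split.
  apply: mult_unitary_scale; first exact: coc_norm.
  by apply: mult_unitary_comp; [exact: U_unitary|apply/mult_unitary_star/U_unitary].
move=> r Pr Pgr; have [t [Pt qt rt]] := Pdir Pq Pr.
apply/(intertwines_mulr _ Pr Pgr rt); rewrite mulVKg -(mulVKg q t).
by apply/(intertwines_mulr _ Pq Pgq qt) => b /=; rewrite fibre_adjK.
Qed.

End FibreUnitaries.

Lemma covariant_extension : exists W : G -> multiplier N,
  covariant_pair alpha omega pi W /\
  forall p x, P p -> mult_adj (W p) (pi x) = J p x.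
Proof.
have [U HU] := fibre_unitaries.
have Uu p : P p -> mult_unitary (U p) by move=> /HU[].
have UJ p x b : P p -> U p (J p x ** b) = pi x ** b by move=> /HU[].
have [W HW] := choice (group_unitary Uu UJ).
have Wu g : mult_unitary (W g) by case: (HW g).
have WU g q b : P q -> P (g * q)%g -> W g (U q b) = omega g q *: U (g * q)%g b.
  by move=> Pq Pgq; case: (HW g) => _; exact.
have Wcov g a b : W g (pi a ** b) = pi (alpha g a) ** W g b.
  have [q [Pq Pgq]] := exists_denominator g.
  rewrite -(fibre_unitaryK Uu b Pq) -{1}(actVK alpha q a) -(fibre_unitary_cov Uu UJ)// !WU//.
  by rewrite (fibre_unitary_cov Uu UJ)// -actM mulgK cmulZr.
exists W; split; first split=> //.
(* A single [t] with [t], [h t] and [g h t] in [P] reduces both sides to the unitary at [g h t],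
   with scalars matched by the cocycle identity. *)
- move=> g h b; have [r [Pr Phr]] := exists_denominator h.
  have [s [Ps Pghs]] := exists_denominator (g * h)%g.
  have [t [Pt rt st]] := Pdir Pr Ps.
  have Pht : P (h * t)%g by rewrite -(mulVKg r t) mulgA; exact: PM.
  have Pght : P (g * (h * t))%g.
    by rewrite mulgA -(mulVKg s t) mulgA; exact: PM.
  rewrite -(fibre_unitaryK Uu b Pt) !WU// ?multZ ?WU// -?mulgA// !scalerA.
  by rewrite [omega g h * _]mulrC cocM mulrC.
- by move=> g a b; rewrite Wcov; case: (Wu g) => _ ->.
- move=> p x Pp; suff <- : W p (J p x) = pi x by case: (Wu p).
  rewrite -[J p x](fibre_unitary1 Uu UJ) WU ?mulg1// coc1r scale1r.
  by rewrite -(fibre_adj_pi Uu UJ)// (fibre_unitaryK Uu).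
Qed.

End CovariantExtension.

(** * Compact operators on the twisted fibres *)

Section TwistedFibreOperators.
Context {R : realType} {G : groupType} {A : cstarAlgType R}.
Variable alpha : cstar_action G A.
Implicit Types (g : G) (a b x y z : A).

Local Notation Y g := (twisted_fibre alpha g).

Lemma cmul_suml I (s : seq I) (F : I -> A) z :
  (\sum_(i <- s) F i) ** z = \sum_(i <- s) F i ** z.
Proof.
by elim: s => [|i s IH]; rewrite ?big_nil ?cmul0l// !big_cons cmulDl IH.
Qed.

Lemma adjointable_mulr g (S : Y g -> Y g) : adjointable S ->
  forall x y, S (x ** y) = (S x : A) ** y :> A.
Proof.
move=> [T ST] x y; apply: cmul_injl => z; rewrite -(starK z).
have ST' u v : star (T u : A) ** v = star u ** (S v : A).
  rewrite -[LHS]starK -[RHS]starK; congr star; rewrite !starM !starK.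
  exact: esym (ST v u).
by rewrite -ST' cmulA ST' cmulA.
Qed.

Definition lmul g a : Y g -> Y g := fun z : A => a ** z.

Lemma compact_lmul g a : compact_op (lmul (g := g) a).
Proof.
split.
  exists (lmul (star a)) => x y.
  by rewrite /inner /= /lmul starM cmulA.
move=> e e0; have [_ [s ->] ae] := prod_lim_all a e0.
exists [seq (u.1, star u.2) | u <- s] => z; rewrite big_map.
have -> : lmul a z - \sum_(u <- s) rank_one (u.1 : Y g) (star u.2 : Y g) z =
    (a - \sum_(u <- s) u.1 ** u.2) ** z :> A.
  rewrite cmulBl cmul_suml; congr (_ - _); apply: eq_bigr => u _.
  by rewrite /rank_one /ract /inner /= starK cmulA.
by apply: le_trans (cnormM _ _) _; rewrite ler_wpM2r.
Qed.

(** Finite-rank approximants are left multiplications by sums of [x ** star y]. Evaluating at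
    [star (x - y)] shows that multipliers [x] and [y] of two approximants are as close as the
    operators, so they converge. *)
Lemma compact_opE g (S : Y g -> Y g) : compact_op S ->
  exists a, forall z, S z = a ** z :> A.
Proof.
move=> [_ Sc].
pose F e := [set c : A | forall z : A, `|(S z : A) - c ** z| <= e * `|z|].
have [e e0|e e' x y e0 e'0 Sx Sy|a Ha] := @complete_approx R A F.
- have [s Hs] := Sc e e0; exists (\sum_(u <- s) (u.1 : A) ** star (u.2 : A)).
  move=> z; apply: le_trans (Hs z); rewrite le_eqVlt; apply/orP; left.
  rewrite cmul_suml; apply/eqP; congr (`|_ - _|); apply: eq_bigr => u _.
  by rewrite /rank_one /ract /inner /= cmulA.
- have [->|xy] := eqVneq x y; first by rewrite subrr normr0 addr_ge0// ltW.
  have n0 : 0 < `|x - y| by rewrite normr_gt0 subr_eq0.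
  rewrite -(ler_pM2r n0) -expr2 -norm_cmul_star -[`|x - y| in leRHS]norm_star.
  rewrite cmulBl -(subrKA (S (star (x - y)) : A)) mulrDl.
  apply: le_trans (ler_normD _ _) _; apply: lerD; last exact: Sy.
  by rewrite distrC; exact: Sx.
exists a => z; apply/eqP; rewrite -subr_eq0; apply/eqP.
apply: (norm_small_eq0 (K := `|z| + `|z|)); first by rewrite addr_ge0.
move=> e e0 _; have [s Hs] := Sc e e0.
pose c : A := \sum_(u <- s) (u.1 : A) ** star (u.2 : A).
have Fc : F e c.
  move=> y; apply: le_trans (Hs y); rewrite le_eqVlt; apply/orP; left.
  rewrite cmul_suml; apply/eqP; congr (`|_ - _|); apply: eq_bigr => u _.
  by rewrite /rank_one /ract /inner /= cmulA.
rewrite -(subrKA (c ** z)) -cmulBl mulrC mulrDr.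
apply: le_trans (ler_normD _ _) _; apply: lerD; first exact: Fc.
by apply: le_trans (cnormM _ _) _; rewrite ler_wpM2r// Ha.
Qed.

(** The identification of the compact operators with [A]; the default [0] is not reached on them, by
    [compact_opE]. *)
Definition symbol g (S : Y g -> Y g) : A :=
  xget 0 [set a : A | forall z, S z = a ** z :> A].

Lemma symbol_unique g (S : Y g -> Y g) a :
  (forall z, S z = a ** z :> A) -> symbol S = a.
Proof.
move=> Sa; apply: xget_unique => // b Sb.
by apply: cmul_injr => z; rewrite -Sa -Sb.
Qed.

Lemma symbolE g (S : Y g -> Y g) : compact_op S ->
  forall z, S z = symbol S ** z :> A.
Proof.
move=> /compact_opE[a Sa].
exact: (xgetPex 0 (P := [set a : A | forall z, S z = a ** z :> A])
  (ex_intro _ a Sa)).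
Qed.

Lemma symbol_comp_lmul g a b :
  symbol ((lmul a : Y g -> Y g) \o lmul b) = a ** b.
Proof. by apply: symbol_unique => z; rewrite /= /lmul cmulA. Qed.

Lemma symbol_rank_one g (x y : Y g) :
  symbol (rank_one x y) = (x : A) ** star (y : A).
Proof. by apply: symbol_unique => z; rewrite /rank_one /ract /inner /= cmulA. Qed.

Lemma compact_rank_one g (x y : Y g) : compact_op (rank_one x y).
Proof.
have -> : rank_one x y = lmul ((x : A) ** star (y : A)).
  by apply/funext => z; rewrite /rank_one /ract /inner /= /lmul cmulA.
exact: compact_lmul.
Qed.

End TwistedFibreOperators.

(** * The maps [iota] on the twisted fibres *)

Section TwistedIota.
Context {R : realType} {G : groupType} {A : cstarAlgType R}.
Variables (alpha : cstar_action G A) (omega : cocycle R G) (P : set G).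
Local Notation X := (twisted_system alpha omega P).

Lemma ps_iotaE (p r : oppg G) (S : X p -> X p) (a : A) :
  P ((r : G) * (p : G)^-1)%g ->
  (forall z, S z = a ** z :> A) ->
  ps_iota (q := r) S = lmul (alpha ((r : G) * (p : G)^-1)%g a).
Proof.
move=> Prp Sa.
set g := ((r : G) * (p : G)^-1)%g.
have Lspec : ps_iota_spec (X := X) S (lmul (alpha g a) : X r -> X r).
  split; first by have [] := compact_lmul alpha r (alpha g a).
  case: eqP => [p1|_].
    exists a; split=> [x|y]; rewrite ?Sa /lact /=.
      by move: x; rewrite p1 => x; rewrite act1.
    by rewrite /lmul /g p1 invg1 mulg1.
  move=> s x y z w Ps /= xyz xyw.
  have rE : r = (p * s)%g by have /(congr1 (@projT1 _ _)) := xyz.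
  have zE := congr1 (fun t : {p & X p : Type} => (projT2 t : A)) xyz.
  have wE := congr1 (fun t : {p & X p : Type} => (projT2 t : A)) xyw.
  move: zE wE => /= <- <-; rewrite /lmul /tw_mul.
  have -> : g = s by rewrite /g rE; exact: mulgK.
  by rewrite Sa act_mul cmulZr cmulA.
(* Uniqueness: adjointable maps are right-linear, so it is enough to know [T z ** v], that is [T] on
   the products [z ** v]. *)
apply: xget_unique => // T [Tadj Tspec].
apply/funext => z; apply: cmul_injr => v.
rewrite -(adjointable_mulr Tadj).
move: Tspec; case: eqP => [p1 [b [Sb Tb]]|_ Tspec].
  rewrite Tb /lact /= /lmul /g p1 invg1 mulg1 cmulA.
  congr (alpha _ _ ** _ ** _).
  apply: cmul_injr => u; rewrite -Sa Sb /lact /=.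
  by rewrite p1 act1.
(* The factors undo the twist by [alpha g] and by the conjugate of [omega g p], so their product in
   the system is [z ** v]. *)
pose x : X p := alpha g^-1%g z; pose y : X g := omega g p *: v.
have xy (u : A) : Num.conj (omega g p) *:
    (alpha g (alpha g^-1%g u) ** (omega g p *: v)) = u ** v.
  by rewrite cmulZr scalerA coc_conjK scale1r actVK.
apply: (Tspec g x y) => //.
  by apply: tw_elt_eq; [exact: (mulgVK (p : G) (r : G))|exact: xy].
apply: tw_elt_eq; first exact: (mulgVK (p : G) (r : G)).
have : Num.conj (omega g p) *:
      (alpha g (a ** alpha g^-1%g z) ** (omega g p *: v))
    = @lmul R G A alpha r (alpha g a) z ** v.
  by rewrite act_mul actVK cmulZr scalerA coc_conjK scale1r /lmul.
by have <- : S x = a ** alpha g^-1%g z :> A := Sa x.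
Qed.

End TwistedIota.

(** * Consequences of CNP-covariance *)

Section CNPTwisted.
Context {R : realType} {G : groupType} {A : cstarAlgType R}.
Variables (alpha : cstar_action G A) (omega : cocycle R G) (P : set G).
Hypotheses (P1 : P 1%g) (PM : forall p q, P p -> P q -> P (p * q)%g).
Hypothesis Pdir_op : directed (opp_cone P).
Local Notation X := (twisted_system alpha omega P).

Lemma act0 g : alpha g 0 = 0.
Proof. exact: hom0 (act_hom alpha g). Qed.

Lemma act_eq0 g a : alpha g a = 0 -> a = 0.
Proof. by move=> a0; rewrite -[a](act1 alpha) -(mulVg g) actM a0 act0. Qed.

Lemma cnp_rank_one (B : cstarAlgType R) (psi : forall p, X p -> B) :
  cnp_representation psi -> forall (p : G) (x y : A), P p ->
  psi p x ** star (psi p y) = psi 1%g (alpha p^-1%g (x ** star y)).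
Proof.
move=> [[psiL _ psi1 _] [K [Kpsi _ Kcp]]] p x y Pp.
have psi1M a b : psi 1%g (a ** star b) = psi 1%g a ** star (psi 1%g b).
  by case: psi1 => _ _ M S; rewrite -(S b) -M.
(* The identity is treated apart because covariance is applied to two distinct elements, [1] and
   [p]. *)
have [->|p1] := eqVneq p 1%g; first by rewrite invg1 act1 psi1M.
rewrite act_mul act_star psi1M.
(* Multiplication by [alpha p^-1 (x ** star y)] over [1], and by [- x ** star y] over [p]. Both are
   written as [rank_one] operators, on which [K] is explicit. *)
pose T (r : oppg G) : X r -> X r := if r == 1%g
  then rank_one (alpha p^-1%g x : X r) (alpha p^-1%g y : X r)
  else rank_one (- x : X r) (y : X r).
have := Kcp [:: 1%g; p : oppg G] T.
rewrite !big_cons big_nil addr0 {3 4}/T eqxx (negbTE p1).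
have [_ _ _ _ ->] := Kpsi 1%g P1; have [_ _ _ _ ->] := Kpsi p Pp.
have -> : psi p (- x) = - psi p x.
  by have [_ Z] := psiL p Pp; rewrite -scaleN1r -[RHS]scaleN1r; exact: Z.
rewrite cmulNl => H; apply/esym/eqP; rewrite -subr_eq0; apply/eqP.
apply: H.
- by rewrite /= andbT inE eq_sym.
- move=> r; rewrite !inE => /orP[] /eqP->; split=> //.
    by rewrite /T eqxx; exact: compact_rank_one.
  by rewrite /T (negbTE p1); exact: compact_rank_one.
move=> q Qq; have [r [Qr qr pr]] := Pdir_op Qq (Pp : opp_cone P p).
exists r; split=> // s Qs rs z zs t; rewrite !big_cons big_nil addr0.
have ps : P ((s : G) * (p : G)^-1)%g.
  have -> : ((s : G) * (p : G)^-1 =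
      ((s : G) * (r : G)^-1) * ((r : G) * (p : G)^-1))%g.
    by rewrite mulgA mulgVK.
  exact: PM.
pose c := x ** star y.
have T1 (w : X 1%g) : T 1%g w = alpha p^-1%g c ** w :> A.
  rewrite /T eqxx /rank_one /ract /inner /= cmulA.
  by rewrite -act_star -act_mul.
have Tp (w : X p) : T p w = (- c) ** w :> A.
  by rewrite /T (negbTE p1) /rank_one /ract /inner /= cmulA cmulNl.
rewrite /iota_tilde.
have [[Pt ts]|nts] := pselect (P t /\ P ((s : G) * (t : G)^-1)%g); last first.
  by rewrite !asboolF ?addr0// => -[Pt ts _]; apply: nts.
have Pt1 : P ((t : G) * (1 : G)^-1)%g by rewrite invg1 mulg1.
rewrite asboolT//.
rewrite (ps_iotaE Pt1 T1) invg1 mulg1.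
(* Above [p], the two images are opposite multiplications on the fibre over [t] and cancel. *)
have [pt|npt] := pselect (P ((t : G) * (p : G)^-1)%g).
  rewrite asboolT// (ps_iotaE pt Tp) /lmul -actM.
  rewrite -[LHS]cmulDl (homN (act_hom _ _)) subrr.
  exact: cmul0l.
rewrite asboolF ?addr0; last by case.
(* As [t] is not above [p], it differs from [s]. The ideal attached to [s t^-1] then annihilates the
   fibre over that very element, so it vanishes because the left action is injective. *)
suff zt0 : z t = 0 :> A by rewrite zt0 /lmul; exact: cmul0r.
case: zs => /(_ t Pt ts)[w [b [bI ->]]] _ _.
suff b0 : b = 0 by rewrite b0; exact: cmul0r.
have st1 : ((s : G) * (t : G)^-1)%g <> 1%g.
  move=> st; apply: npt; suff -> : t = s :> G by [].
  by rewrite -[LHS](@mul1g G) -st (@mulgVK G).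
case: bI => [/st1//|/(_ ((s : G) * (t : G)^-1)%g ts st1) bI].
apply: (@act_eq0 ((s : G) * (t : G)^-1)%g).
apply: cmul_injr => v; rewrite cmul0l.
by apply: (bI _ v); rewrite /qle mulVg.
Qed.

Lemma exists_upper_bound (F : seq G) : (forall p, p \in F -> P p) ->
  exists q, P q /\ forall p, p \in F -> P (q * p^-1)%g.
Proof.
elim: F => [_|p F IH FP]; first by exists 1%g.
have [|q [Pq qF]] := IH; first by move=> r rF; apply: FP; rewrite inE rF orbT.
have Pp : P p by apply: FP; rewrite inE eqxx.
have [r [Pr qr pr]] := Pdir_op (Pq : opp_cone P q) (Pp : opp_cone P p).
exists r; split=> // s; rewrite inE => /orP[/eqP->//|/qF qs].
have -> : ((r : G) * s^-1 = ((r : G) * q^-1) * (q * s^-1))%g by rewrite mulgA mulgVK.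
exact: PM.
Qed.

End CNPTwisted.

(** * From a covariant pair to a CNP-covariant representation *)

Section CovariantCNP.
Context {R : realType} {G : groupType} {A : cstarAlgType R}.
Variables (alpha : cstar_action G A) (omega : cocycle R G) (P : set G).
Hypotheses (P1 : P 1%g) (PM : forall p q, P p -> P q -> P (p * q)%g).
Hypothesis Pdir_op : directed (opp_cone P).
Local Notation X := (twisted_system alpha omega P).
Variables (C : cstarAlgType R) (iA : A -> C) (iG : G -> multiplier C).
Hypothesis iAG : covariant_pair alpha omega iA iG.

Definition covariant_rep (p : oppg G) (x : X p) : C := mult_adj (iG p) (iA x).

(** By covariance this is the conjugate of [iA (symbol S)] by [iG p], with the adjoint on the
    left. *)
Definition covariant_repK (p : oppg G) (S : X p -> X p) : C :=
  iA (alpha (p : G)^-1%g (symbol S)).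

Lemma iA_hom : cstar_hom iA. Proof. by case: iAG. Qed.

Lemma iGK g b : mult_adj (iG g) (iG g b) = b.
Proof. by case: iAG => _ /(_ g)[]. Qed.

Lemma iGVK g b : iG g (mult_adj (iG g) b) = b.
Proof. by case: iAG => _ /(_ g)[]. Qed.

Lemma iGM g h b : iG g (iG h b) = omega g h *: iG (g * h)%g b.
Proof. by case: iAG. Qed.

Lemma iG_adjM g h b : mult_adj (iG h) (mult_adj (iG g) b) =
  Num.conj (omega g h) *: mult_adj (iG (g * h)%g) b.
Proof.
rewrite -{1}(iGVK (g * h)%g b) -[iG _ _]scale1r -(coc_conjK omega g h) -scalerA.
by rewrite -iGM !mult_adjZ !iGK.
Qed.

Lemma iG1 b : iG 1%g b = b.
Proof.
have := iGM 1%g 1%g b; rewrite coc1 scale1r mulg1 => /(congr1 (mult_adj (iG 1%g))).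
by rewrite !iGK.
Qed.

Lemma iG1_adj b : mult_adj (iG 1%g) b = b.
Proof. by rewrite -{1}(iG1 b) iGK. Qed.

Lemma iG_adj_cov g a b :
  iA a ** mult_adj (iG g) b = mult_adj (iG g) (iA (alpha g a) ** b).
Proof. by case: iAG => _ _ _ <-; rewrite iGK. Qed.

Lemma covariant_representation : representation covariant_rep.
Proof.
have hA := iA_hom; split.
- move=> p Pp; split=> [x y|l x]; rewrite /covariant_rep.
    by rewrite -mult_adjD -(homD hA).
  by rewrite -mult_adjZ -(homZ hA).
- move=> p q x y Pp Pq; rewrite /covariant_rep.
  rewrite -mult_adjM iG_adj_cov iG_adjM -mult_adjZ -(homM hA) -(homZ hA).
  by [].
- by split=> *; rewrite /covariant_rep !iG1_adj /= /tw_unit; case: hA => D Z M S;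
     rewrite ?D ?Z ?M ?S.
- move=> p x y Pp; rewrite /covariant_rep iG1_adj mult_adjPV iGVK.
  by rewrite -(hom_star hA) -(homM hA).
Qed.

Lemma covariant_is_psi_compact (p : oppg G) :
  is_psi_compact (@covariant_rep p) (@covariant_repK p).
Proof.
have hA := iA_hom; have hp := act_hom alpha (p : G)^-1%g.
rewrite /covariant_repK; split.
- move=> S T Sc Tc; rewrite -(homD hA) -(homD hp); congr (iA (alpha _ _)).
  by apply: symbol_unique => z; rewrite cmulDl -!symbolE.
- move=> l S Sc; rewrite -(homZ hA) -(homZ hp); congr (iA (alpha _ _)).
  by apply: symbol_unique => z; rewrite cmulZl -!symbolE.
- move=> S T Sc Tc; rewrite -(homM hA) -(homM hp); congr (iA (alpha _ _)).
  by apply: symbol_unique => z; rewrite -cmulA -!symbolE.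
- move=> S T Sc Tc ST; rewrite -(hom_star hA) -(hom_star hp); congr (iA (alpha _ _)).
  apply: cmul_injr => z; rewrite -(symbolE Tc); apply: cmul_injl => w.
  rewrite -(starK w) -[LHS](ST (star w) z) (symbolE Sc).
  by rewrite /inner /= starM cmulA.
- move=> x y; rewrite symbol_rank_one; apply: cmul_injr => c.
  rewrite -[c in LHS](iGK p) iG_adj_cov actVK (homM hA) (hom_star hA).
  by rewrite -!cmulA mult_adjPV mult_adjM.
Qed.

(** Passing to the fibre over [r] applies [alpha] at [r p^-1], which the inverse of [alpha r]
    reduces to that of [alpha p]. Directedness excludes the case without upper bound. *)
Lemma covariant_nica : nica_covariant covariant_repK.
Proof.
move=> p q S T Pp Pq Sc Tc; split; last by move=> nub; case: nub; exact: Pdir_op.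
move=> r [[Pr pr qr] _]; rewrite /covariant_repK -(homM iA_hom).
rewrite (ps_iotaE pr (symbolE Sc)) (ps_iotaE qr (symbolE Tc)).
by rewrite (@symbol_comp_lmul _ _ _ alpha r) act_mul -!actM !mulKg.
Qed.

(** Vectors supported at [q] serve to test covariance; no restriction arises there because the ideal
    at the identity is all of [A]. *)
Lemma Xtilde_delta (q : oppg G) (y a : A) : P q ->
  Xtilde q (fun t : oppg G => (if t == q then y ** a else 0) : X t).
Proof.
move=> Pq; split.
- move=> t Pt tq; case: eqP => [tE|_].
    by exists y, a; split=> //; left; rewrite tE mulVg.
  exists (0 : A), (0 : A); split; last by rewrite /ract /= cmul0l.
  by right=> p _ _ _ x; rewrite /lact /= act0 cmul0l.
- move=> t nt; case: eqP => // tE; case: nt; rewrite tE; split=> //.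
  by rewrite /qle mulVg.
- exists (star (y ** a) ** (y ** a)) => e e0; exists [:: q] => s us qs.
  rewrite (bigD1_seq q) ?qs ?inE//= big1 => [|t /negbTE->].
    by rewrite eqxx addr0 subrr normr0 ltW.
  by rewrite /inner /= cmul0r.
Qed.

Lemma covariant_cuntz_pimsner : cuntz_pimsner_covariant covariant_repK.
Proof.
move=> F T uF FP large; have hA := iA_hom.
have [q0 [Pq0 q0F]] := exists_upper_bound P1 PM Pdir_op (fun p pF => (FP p pF).1).
have [q [Pq q0q /(_ q Pq)]] := large q0 Pq0.
have Pqq : qle (opp_cone P) q q by rewrite /qle mulVg.
move=> /(_ Pqq) H.
have qF p : p \in F -> P ((q : G) * (p : G)^-1)%g.
  move=> /q0F q0p.
  have -> : ((q : G) * (p : G)^-1 = ((q : G) * q0^-1) * (q0 * (p : G)^-1))%g.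
    by rewrite mulgA mulgVK.
  exact: PM.
rewrite /covariant_repK -(hom_sum hA).
suff -> : \sum_(p <- F) alpha (p : G)^-1%g (symbol (T p)) = 0 by exact: hom0.
(* After [alpha q], the sum consists of the symbols transported to the fibre over [q]; the
   hypothesis on vectors supported there kills it, and [y] and [a] cancel. *)
apply: (@act_eq0 _ _ _ alpha q).
rewrite (hom_sum (act_hom alpha q)).
apply: cmul_injr => y; rewrite cmul0l; apply: cmul_injr => a; rewrite cmul0l.
rewrite -cmulA cmul_suml -[RHS](H _ (Xtilde_delta y a Pq) q).
apply: eq_big_seq => p pF; rewrite /iota_tilde asboolT; last first.
  by split=> //; exact: qF.
rewrite eqxx (ps_iotaE (qF p pF) (symbolE (FP p pF).2)).
by rewrite -actM.
Qed.

Lemma covariant_cnp : cnp_representation covariant_rep.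
Proof.
split; first exact: covariant_representation.
exists covariant_repK; split.
- by move=> p _; exact: covariant_is_psi_compact.
- exact: covariant_nica.
- exact: covariant_cuntz_pimsner.
Qed.

End CovariantCNP.

(** * Comparison of the two universal algebras *)

(** The elements at which [f] intertwines the unitaries form a subgroup, since both families obey
    the same cocycle relation; over [P] the adjoint relation is inverted. *)
Lemma intertwine_generated (R : realType) (G : groupType) (A : cstarAlgType R)
    (alpha : cstar_action G A) (omega : cocycle R G) (P : set G)
    (N C : cstarAlgType R) (pi : A -> N) (W : G -> multiplier N)
    (iA : A -> C) (iG : G -> multiplier C) (f : N -> C) :
  generated_by P ->
  covariant_pair alpha omega pi W -> covariant_pair alpha omega iA iG ->
  cstar_hom f ->
  (forall p b, P p -> f (mult_adj (W p) b) = mult_adj (iG p) (f b)) ->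
  forall g b, f (W g b) = iG g (f b).
Proof.
move=> Pgen cW ciG hf fP g.
pose K := [set g | forall b, f (W g b) = iG g (f b)].
suff : K = setT by move/seteqP => [_ /(_ g I)].
have KM (h k : G) : K h -> K k -> K (h * k)%g.
  move=> Kh Kk b; rewrite -[W _ _]scale1r -[iG _ _]scale1r -(coc_conjK omega h k).
  rewrite -!scalerA (homZ hf); congr (_ *: _).
  by rewrite -(iGM cW) -(iGM ciG) Kh Kk.
apply: Pgen => //.
- by move=> b; rewrite (iG1 cW) (iG1 ciG).
- move=> h Kh b; rewrite -[iG h^-1%g _](iGK ciG h) -[W h^-1%g b](iGK cW h).
  rewrite (iGM cW) (iGM ciG) mulgV (iG1 cW) (iG1 ciG).
  by rewrite -[in RHS](homZ hf) -[in RHS](iGVK cW h (_ *: b)) Kh (iGK ciG).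
- by move=> p Pp b; rewrite -[LHS](iGVK ciG p) -fP// (iGK cW).
Qed.

Theorem corollary5p2 (R : realType) (G : groupType) (P : set G)
    (A : cstarAlgType R) (alpha : cstar_action G A) (omega : cocycle R G)
    (hqlo : quasi_lattice_ordered P) (hdir : directed P)
    (hgen : generated_by P)
    (hdir_op : directed (opp_cone P))
    (C : cstarAlgType R) (iA : A -> C) (iG : G -> multiplier C)
    (hC : is_crossed_product alpha omega iA iG)
    (N : cstarAlgType R)
    (j : forall p, twisted_system alpha omega P p -> N)
    (hN : is_NO j) :
  exists Phi : C -> N,
    [/\ cstar_hom Phi, bijective Phi
      & forall (p : G) (x : A), P p ->
          Phi (mult_adj (iG p) (iA x)) = j p x].
Proof.
have [PM P_unit _] := hqlo.
have P1 : P 1%g by have /seteqP[_ /(_ _ erefl)[]] := P_unit.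
have [ciG _ Cuniv] := hC; have [jcnp jgen Nuniv] := hN.
have [[jL jM j1 j_inner] _] := jcnp.
pose J (g : G) (x : A) : N := j g x.
have JD p x y : P p -> J p (x + y) = J p x + J p y by case/jL => + _; exact.
have JZ p l x : P p -> J p (l *: x) = l *: J p x by case/jL => _; exact.
have JM p q x y : P p -> P q ->
    J (q * p)%g (Num.conj (omega q p) *: (alpha q x ** y)) = J p x ** J q y.
  exact: jM.
have J1 : cstar_hom (J 1%g) by [].
have J_inner p x y : P p -> J 1%g (star x ** y) = star (J p x) ** J p y.
  exact: j_inner.
have J_rank_one p x y : P p ->
    J p x ** star (J p y) = J 1%g (alpha p^-1%g (x ** star y)).
  exact: (cnp_rank_one P1 PM hdir_op jcnp).
have [W [cW WJ]] :=
  covariant_extension P1 PM hdir hgen JD JZ JM J1 J_inner J_rank_one jgen.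
have [Phi [[hPhi Phi_iA Phi_iG] _]] := Cuniv _ _ _ cW.
have [Psi [[hPsi Psi_j] _]] := Nuniv _ _ (covariant_cnp P1 PM hdir_op ciG).
have Phi_adj p b : Phi (mult_adj (iG p) b) = mult_adj (W p) (Phi b).
  by rewrite -[LHS](iGK cW p) -Phi_iG (iGVK ciG).
(* Universality fixes [Psi] on the fibres only. Its compatibility with the unitaries is checked on
   the dense span of the [J 1 x ** d], where the adjoint of [W p] yields [J p x]. *)
have Psi_adj p b : P p -> Psi (mult_adj (W p) b) = mult_adj (iG p) (Psi b).
  move=> Pp; apply/eqP; rewrite -subr_eq0; apply/eqP.
  pose F b := Psi (mult_adj (W p) b) - mult_adj (iG p) (Psi b).
  have [_ Wu _ _] := cW; have [_ iGu _ _] := ciG.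
  apply: (approximable_eq0 (F := F) (K := 2 + 2)
    (pi_approximable P1 JD JZ JM J1 J_inner jgen)).
  - by move=> u v; rewrite /F (homD hPsi) !mult_adjD (homD hPsi) opprD addrACA.
  - by [].
  - move=> u; apply: le_trans (ler_normB _ _) _; rewrite mulrDl.
    rewrite (mult_unitary_adj_norm _ (iGu p)); apply: lerD; last exact: hom_bounded.
    apply: le_trans (hom_bounded hPsi _) _.
    by rewrite (mult_unitary_adj_norm _ (Wu p)).
  - move=> x d; rewrite /F mult_adjM WJ// !(homM hPsi) mult_adjM.
    rewrite [Psi (J p x)](Psi_j p x Pp) [Psi (J 1%g x)](Psi_j 1%g x P1).
    by rewrite /covariant_rep (iG1_adj ciG) subrr.
have Psi_W := intertwine_generated hgen cW ciG hPsi Psi_adj.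
exists Phi; split=> //; last first.
  by move=> p x Pp; rewrite Phi_adj Phi_iA WJ.
have [idC [_ idC_unique]] := Cuniv _ _ _ ciG.
have [idN [_ idN_unique]] := Nuniv _ _ jcnp.
exists Psi => b.
  (* The composite and the identity both solve the universal problem posed by [iA] and [iG], so both
     equal its unique solution; the other composite is treated likewise in [N]. *)
  have PP : idC = Psi \o Phi.
    apply: idC_unique; split.
    - by split=> * /=; rewrite ?(homD hPhi) ?(homZ hPhi) ?(homM hPhi)
        ?(hom_star hPhi) ?(homD hPsi) ?(homZ hPsi) ?(homM hPsi) ?(hom_star hPsi).
    - move=> a /=; rewrite Phi_iA [LHS](Psi_j 1%g a P1).
      by rewrite /covariant_rep (iG1_adj ciG).
    - by move=> g c /=; rewrite Phi_iG Psi_W.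
  have II : idC = id by apply: idC_unique; split.
  by rewrite -[LHS]/((Psi \o Phi) b) -PP II.
have PP : idN = Phi \o Psi.
  apply: idN_unique; split.
  - by split=> * /=; rewrite ?(homD hPsi) ?(homZ hPsi) ?(homM hPsi)
      ?(hom_star hPsi) ?(homD hPhi) ?(homZ hPhi) ?(homM hPhi) ?(hom_star hPhi).
  - move=> p x Pp /=; rewrite Psi_j// /covariant_rep Phi_adj Phi_iA.
    exact: WJ.
have II : idN = id by apply: idN_unique; split.
by rewrite -[LHS]/((Phi \o Psi) b) -PP II.
Qed.
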